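(* Let $G$ be a finite $p$-group ($p$ a prime), let $\mathbb{L}$ be the lattice of normal subgroups of $G$, and let $\{e\}=N_0<\cdots<N_n=G$ be the sequence of all those normal subgroups that cut the lattice $\mathbb{L}$. Then the following are equivalent: (1) The clone of congruence preserving functions of $G$ is finitely generated. (2) For each $i\in\{0,\dots,n-1\}$, the interval $\mathbb{I}[N_i,N_{i+1}]$ of the lattice of normal subgroups of $G$ either contains exactly two elements, or $\mathbb{I}[N_i,N_{i+1}]$ does not split.
   Context: A function $f:G^k\to G$ is congruence preserving if for all $(g_1,\dots,g_k),(h_1,\dots,h_k)\in G^k$ the element $f(g_1,\dots,g_k)^{-1}f(h_1,\dots,h_k)$ lies in the normal subgroup of $G$ generated by $\{g_1^{-1}h_1,\dots,g_k^{-1}h_k\}$ (equivalently, $f$ preserves every congruence of $G$). The congruence preserving functions of all arities $k\ge1$ form a clone (a set of finitary operations containing all projections and closed under composition); it is finitely generated if it has a finite subset $F$ such that each of its members is a composition of projections and functions in $F$. For elements $a\le b$ of a lattice $\mathbb{L}$, $\mathbb{I}[a,b]=\{c\in\mathbb{L}: a\le c\le b\}$. An element $\beta$ of a bounded lattice cuts the lattice if every $\alpha$ in the lattice satisfies $\alpha\le\beta$ or $\alpha\ge\beta$; the cutting elements form a chain containing the least and greatest elements. A bounded lattice $\mathbb{L}$ with least element $\mathbf 0$ and greatest element $\mathbf 1$ splits if there are $\delta,\varepsilon\in\mathbb{L}$ with $\delta<\mathbf 1$, $\varepsilon>\mathbf 0$ such that every $\alpha\in\mathbb{L}$ satisfies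 $\alpha\le\delta$ or $\alpha\ge\varepsilon$. *)

(* Defs.v *)
From HB Require Import structures.
From mathcomp Require Import all_boot all_order all_fingroup all_solvable.

Set Implicit Arguments.
Unset Strict Implicit.
Unset Printing Implicit Defensive.

Import GroupScope.

Definition operation (T : finType) (k : nat) := {ffun k.-tuple T -> T}.

Definition projection (T : finType) (k : nat) (i : 'I_k) : operation T k :=
  [ffun x => tnth x i].

Definition composition (T : finType) (k n : nat)
    (f : operation T k) (g : 'I_k -> operation T n) : operation T n :=
  [ffun x => f [tuple g i x | i < k]].

(* [C k f] reads: the [k]-ary operation [f] belongs to [C]. *)
Definition operation_set (T : finType) := forall k : nat, operation T k -> Prop.

Definition any_operation (T : finType) := {k : nat & operation T k}.

Inductive generated_clone (T : finType) (F : seq (any_operation T)) :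
    operation_set T :=
| Generator f of f \in F : generated_clone F (tagged f)
| Projection k (i : 'I_k) : generated_clone F (projection T i)
| Composition k n (f : operation T k) (g : 'I_k -> operation T n) of
    generated_clone F f & (forall i, generated_clone F (g i)) :
    generated_clone F (composition f g).

Definition finitely_generated (T : finType) (C : operation_set T) : Prop :=
  exists F : seq (any_operation T),
    (forall f, f \in F -> C (tag f) (tagged f)) /\
    (forall k (f : operation T k), C k f -> generated_clone F f).

Definition normal_closure (gT : finGroupType) (A : {set gT}) : {set gT} :=
  \bigcap_(N : {group gT} | (N <| [set: gT]) && (A \subset N)) N.

(* Operations of arity 0 are excluded. *)
Definition congruence_preserving (gT : finGroupType) : operation_set gT :=
  fun k f => 0 < k /\
    forall g h : k.-tuple gT,
      (f g)^-1 * f h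
        \in normal_closure [set (tnth g i)^-1 * tnth h i | i : 'I_k].

Record normal_subgroup (gT : finGroupType) := NormalSubgroup {
  group_of_normal :> {group gT};
  normal_subgroupP : group_of_normal <| [set: gT] }.

HB.instance Definition _ (gT : finGroupType) :=
  [isSub for @group_of_normal gT].
HB.instance Definition _ (gT : finGroupType) :=
  [Finite of normal_subgroup gT by <:].

Fact normal_subgroup_display : Order.disp_t. Proof. exact: Order.Disp tt tt. Qed.

Definition normal_subgroup_le (gT : finGroupType) : rel (normal_subgroup gT) :=
  fun M N => M \subset N.

Fact normal_subgroup_le_refl gT : reflexive (@normal_subgroup_le gT).
Proof. by move=> M; apply: subxx. Qed.

Fact normal_subgroup_le_anti gT : antisymmetric (@normal_subgroup_le gT).
Proof. by move=> M N MN; apply/val_inj/group_inj/eqP; rewrite eqEsubset. Qed.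

Fact normal_subgroup_le_trans gT : transitive (@normal_subgroup_le gT).
Proof. by move=> M N K; apply: subset_trans. Qed.

HB.instance Definition _ (gT : finGroupType) :=
  Order.Le_isPOrder.Build normal_subgroup_display (normal_subgroup gT)
    (@normal_subgroup_le_refl gT) (@normal_subgroup_le_anti gT)
    (@normal_subgroup_le_trans gT).

Definition normal_subgroup_meet (gT : finGroupType) (M N : normal_subgroup gT) :
    normal_subgroup gT :=
  NormalSubgroup (normalI (normal_subgroupP M) (normal_subgroupP N)).

Definition normal_subgroup_join (gT : finGroupType) (M N : normal_subgroup gT) :
    normal_subgroup gT :=
  NormalSubgroup (normalY (normal_subgroupP M) (normal_subgroupP N)).

Fact normal_subgroup_lexI gT (K M N : normal_subgroup gT) :
  (K <= normal_subgroup_meet M N)%O = ((K <= M)%O && (K <= N)%O).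
Proof. exact: subsetI. Qed.

Fact normal_subgroup_leUx gT (M N K : normal_subgroup gT) :
  (normal_subgroup_join M N <= K)%O = ((M <= K)%O && (N <= K)%O).
Proof. exact: join_subG. Qed.

HB.instance Definition _ (gT : finGroupType) :=
  Order.POrder_isMeetSemilattice.Build normal_subgroup_display
    (normal_subgroup gT) (@normal_subgroup_lexI gT).
HB.instance Definition _ (gT : finGroupType) :=
  Order.POrder_isJoinSemilattice.Build normal_subgroup_display
    (normal_subgroup gT) (@normal_subgroup_leUx gT).

Fact normal_subgroup_le0x gT (M : normal_subgroup gT) :
  (NormalSubgroup (normal1 [set: gT]%G) <= M)%O.
Proof. exact: sub1G. Qed.

Fact normal_subgroup_lex1 gT (M : normal_subgroup gT) :
  (M <= NormalSubgroup (normal_refl [set: gT]%G))%O.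
Proof. exact: subsetT. Qed.

HB.instance Definition _ (gT : finGroupType) :=
  Order.hasBottom.Build normal_subgroup_display (normal_subgroup gT)
    (@normal_subgroup_le0x gT).
HB.instance Definition _ (gT : finGroupType) :=
  Order.hasTop.Build normal_subgroup_display (normal_subgroup gT)
    (@normal_subgroup_lex1 gT).

Definition cuts d (L : tbLatticeType d) (b : L) : Prop :=
  forall a : L, (a <= b)%O \/ (a >= b)%O.

Definition interval d (L : latticeType d) (a b : L) : {pred L} :=
  [pred c | (a <= c)%O && (c <= b)%O].

(* Splitting of the interval [a, b], regarded as a bounded lattice with least
   element [a] and greatest element [b]. *)
Definition interval_splits d (L : latticeType d) (a b : L) : Prop :=
  exists delta epsilon : L,
    [/\ delta \in interval a b, epsilon \in interval a b,
        (delta < b)%O, (epsilon > a)%O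
      & forall c : L, c \in interval a b -> (c <= delta)%O \/ (c >= epsilon)%O].

(* Main.v *)
From HB Require Import structures.
From mathcomp Require Import all_boot all_order all_fingroup all_solvable.
From mathcomp Require Import all_algebra all_field.
Require Import Defs.

(** The lattice of normal subgroups is a stack of intervals [[N i, N i.+1]]
    between consecutive cutting elements, and the argument treats one interval
    [[Z, H]] at a time, working modulo [Z].

    Sufficiency.  Because [H] cuts, a function with values in [H] may be
    prescribed independently on the cosets of [H], and nested binary switches
    assemble the pieces ([expressible_glue]).  In a two-element interval the
    same can be done with cosets of [Z], on which the pieces are constant.  In a
    non-splitting interval the piece living on the power of [H] is a product of
    corrections, one for each set of variables, that vanish when one of their
    variables is 1; non-splitting forces corrections in [#|H|] or more
    variables to be trivial ([absorbing_trivial]).  So operations of bounded arity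
    suffice to approximate any congruence preserving function modulo [Z], and
    descending through the stack gives equality.

    Necessity.  Suppose [[Z, H]] splits and is not a two-element interval.  In a
    p-group, any two distinct normal subgroups of index [p] over their
    intersection admit a diagonal, so the absence of cutting elements inside
    [[Z, H]] yields diamonds everywhere, and these carry centrality from the top
    of the interval to its bottom ([central_series]): there is a chain from [H]
    down to [Z] with steps of index [p] along which every congruence preserving
    function is affine, with coefficients that are constant on cosets of [H].
    Restrict functions to a cube [{1, c}^k] with [c] in [H], and measure them by
    the degree over the field with [p] elements.  One step down the chain, an
    operation acts on the new coordinate affinely, up to a function of the old
    coordinates whose degree is controlled by the arity of the operation.  So
    all functions in a finitely generated clone have degree modulo [Z] bounded
    independently of the number of variables ([expressible_degree_bounded]).
    But a splitting pair [D < H], [E > Z] makes every function from cosets of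
    [D] to [E] congruence preserving, including conjunctions in any number of
    variables ([unbounded_degree]). *)

Set Implicit Arguments.
Unset Strict Implicit.
Unset Printing Implicit Defensive.

(** * Functions compatible with congruences *)

Section Congruence.
Local Open Scope group_scope.
Variable gT : finGroupType.
Implicit Types (A B N W Z H K : {group gT}) (x y z t : gT).

Definition congr_mod (A : {set gT}) x y := x^-1 * y \in A.

(** Functions of finitely many variables are taken on ['I_k -> gT] rather than
    on tuples, so that substitutions of variables are plain function
    compositions.  Instantiating [N] with the trivial group makes every
    compatible function extensional in its argument (see [compatible_ext]). *)
Definition compatible (I : Type) (f : (I -> gT) -> gT) :=
  forall N, N <| [set: gT] -> forall u v : I -> gT,
    (forall i, congr_mod N (u i) (v i)) -> congr_mod N (f u) (f v).

(** Congruence modulo [N] becomes equality in the quotient, where products can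
    be rewritten; all compatibility with the group operations follows. *)
Lemma congr_coset N x y : N <| [set: gT] ->
  congr_mod N x y = (coset N x == coset N y).
Proof.
move=> /andP[_ /subsetP nN]; have n z : z \in 'N(N) by apply: nN; rewrite inE.
apply/idP/eqP => [Nxy|exy].
  by rewrite -[y in RHS](mulKVg x) morphM //= (coset_id Nxy) mulg1.
by apply: coset_idr => //; rewrite morphM // morphV //= exy mulVg.
Qed.

Lemma cosetM N x y : N <| [set: gT] -> coset N (x * y) = coset N x * coset N y.
Proof. by move=> /andP[_ /subsetP nN]; rewrite morphM // nN // inE. Qed.

Lemma cosetV N x : N <| [set: gT] -> coset N x^-1 = (coset N x)^-1.
Proof. by move=> /andP[_ /subsetP nN]; rewrite morphV // nN // inE. Qed.

Lemma congr_refl N x : congr_mod N x x.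
Proof. by rewrite /congr_mod mulVg group1. Qed.

Lemma congr_sym N x y : congr_mod N x y = congr_mod N y x.
Proof. by rewrite /congr_mod -groupV invMg invgK. Qed.

Lemma congr_trans N x y z : congr_mod N x y -> congr_mod N y z -> congr_mod N x z.
Proof.
by rewrite /congr_mod => Nxy /(groupM Nxy); rewrite -mulgA mulKVg.
Qed.

Lemma congr_sub A B x y : A \subset B -> congr_mod A x y -> congr_mod B x y.
Proof. by move=> /subsetP; apply. Qed.

Lemma congr_from1 N x : congr_mod N 1 x = (x \in N).
Proof. by rewrite /congr_mod invg1 mul1g. Qed.

Lemma congr_mem N x y : congr_mod N x y -> (x \in N) = (y \in N).
Proof.
by rewrite /congr_mod => Nxy; rewrite -[y](mulKVg x) groupMr.
Qed.

Lemma congrM N x x' y y' : N <| [set: gT] ->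
  congr_mod N x x' -> congr_mod N y y' -> congr_mod N (x * y) (x' * y').
Proof.
by move=> nN; rewrite !congr_coset // !cosetM // => /eqP-> /eqP->.
Qed.

Lemma congrV N x x' : N <| [set: gT] ->
  congr_mod N x x' -> congr_mod N x^-1 x'^-1.
Proof. by move=> nN; rewrite !congr_coset // !cosetV // => /eqP->. Qed.

Lemma compatible_ext I (f : (I -> gT) -> gT) u v :
  compatible f -> u =1 v -> f u = f v.
Proof.
move=> cf uv; have := cf 1%G (normal1 _) u v.
rewrite /congr_mod => /(_ (fun i => _)).
rewrite inE -eq_mulVg1 => h; apply/eqP; apply: h => i.
by rewrite uv mulVg group1.
Qed.

Lemma compatible_proj I (i : I) : compatible (fun u => u i).
Proof. by move=> N _ u v; apply. Qed.

Lemma compatible_const I x : compatible (fun _ : I -> gT => x).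
Proof. by move=> N _ u v _; apply: congr_refl. Qed.

Lemma compatible_comp I J (f : (I -> gT) -> gT) (g : I -> (J -> gT) -> gT) :
  compatible f -> (forall i, compatible (g i)) ->
  compatible (fun u => f (fun i => g i u)).
Proof. by move=> cf cg N nN u v uv; apply: cf => // i; apply: cg. Qed.

Lemma compatibleM I (f g : (I -> gT) -> gT) :
  compatible f -> compatible g -> compatible (fun u => f u * g u).
Proof. by move=> cf cg N nN u v uv; apply: congrM; [|apply: cf|apply: cg]. Qed.

Lemma compatibleV I (f : (I -> gT) -> gT) :
  compatible f -> compatible (fun u => (f u)^-1).
Proof. by move=> cf N nN u v uv; apply: congrV; [|apply: cf]. Qed.

Lemma normal_closure_sub (A : {set gT}) N : N <| [set: gT] ->
  A \subset N -> normal_closure A \subset N.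
Proof. by move=> nN AN; apply: bigcap_inf; rewrite nN. Qed.

(** Lying in the normal closure of the differences of the arguments is the same
    as lying in each normal subgroup that contains these differences. *)
Lemma congruence_preservingP k (f : operation gT k) :
  congruence_preserving f <->
  0 < k /\ compatible (fun u : 'I_k -> gT => f (mktuple u)).
Proof.
split=> [[k0 cf]|[k0 cf]]; split=> //.
  move=> N nN u v uv; apply: (subsetP _ _ (cf _ _)); apply: normal_closure_sub => //.
  apply/subsetP=> _ /imsetP[i _ ->]; rewrite !tnth_mktuple; exact: uv.
move=> g h; apply/bigcapP => N /andP[nN /subsetP sN].
have := cf N nN (tnth g) (tnth h).
have E (w : k.-tuple gT) : [tuple tnth w i | i < k] = w.
  by apply: eq_from_tnth => i; rewrite tnth_mktuple.
rewrite !E; apply=> i; apply: sN; exact: imset_f.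
Qed.

Definition congruence_preservingb k (f : operation gT k) : bool :=
  (0 < k)%N && [forall g : k.-tuple gT, forall h : k.-tuple gT, (f g)^-1 * f h
     \in normal_closure [set (tnth g i)^-1 * tnth h i | i : 'I_k]].

Lemma congruence_preservingbP k (f : operation gT k) :
  reflect (congruence_preserving f) (congruence_preservingb f).
Proof.
apply: (iffP andP) => [[k0 /forallP cf]|[k0 cf]]; split=> //.
  by move=> g h; have /forallP := cf g; apply.
by apply/forallP=> g; apply/forallP=> h; apply: cf.
Qed.

End Congruence.


(** * Expressible functions and switches *)

Section Generation.
Local Open Scope group_scope.
Variables (gT : finGroupType) (F : seq (any_operation gT)).
Implicit Types (N W Z H K : {group gT}) (x y : gT).

Definition expressible k (f : ('I_k -> gT) -> gT) :=
  exists2 t : operation gT k, generated_clone F t & forall u, t (mktuple u) = f u.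

Lemma expressible_proj k (i : 'I_k) : expressible (fun u => u i).
Proof.
exists (projection gT i); first exact: Projection.
by move=> u; rewrite ffunE tnth_mktuple.
Qed.

Lemma expressible_comp k n (f : ('I_k -> gT) -> gT) (g : 'I_k -> ('I_n -> gT) -> gT) :
  expressible f -> (forall i, expressible (g i)) ->
  expressible (fun u => f (fun i => g i u)).
Proof.
move=> [t Ft ft] gg.
have [s sP] : exists s : {ffun 'I_k -> operation gT n},
    forall i, generated_clone F (s i) /\ forall u, s i (mktuple u) = g i u.
  have /fin_all_exists[s sP] : forall i, exists s : operation gT n,
      generated_clone F s /\ forall u, s (mktuple u) = g i u.
    by move=> i; have [s] := gg i; exists s.
  by exists (finfun s) => i; rewrite ffunE.
exists (composition t s); first by apply: Composition => // i; case: (sP i).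
move=> u; rewrite ffunE -ft; congr (t _); apply: eq_mktuple => i.
by case: (sP i).
Qed.

Lemma expressible_eq k (f g : ('I_k -> gT) -> gT) :
  f =1 g -> expressible f -> expressible g.
Proof. by move=> fg [t Ft ft]; exists t => // u; rewrite ft fg. Qed.

Lemma generated_clone_congruence_preserving k (t : operation gT k) :
  (forall f, f \in F -> congruence_preserving (tagged f)) ->
  generated_clone F t -> congruence_preserving t.
Proof.
move=> cF; elim=> {k t} [f /cF //|k i|k n f g _ cf _ cg].
  apply/congruence_preservingP; split; first exact: leq_trans (ltn_ord i).
  move=> N nN u v uv; rewrite !ffunE !tnth_mktuple; exact: uv.
have [k0 {}cf] := (congruence_preservingP _).1 cf.
apply/congruence_preservingP; split.
  by case: (cg (Ordinal k0)).
move=> N nN u v uv; rewrite !ffunE; apply: cf => // i.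
by have [_ cgi] := (congruence_preservingP _).1 (cg i); apply: cgi.
Qed.

Hypothesis F_cp : forall f, f \in F -> congruence_preserving (tagged f).

Lemma expressible_compatible k (f : ('I_k -> gT) -> gT) :
  expressible f -> compatible f.
Proof.
case=> t Ft ft N nN u v uv; rewrite -!ft.
have cpt := generated_clone_congruence_preserving F_cp Ft.
have [_ ct] := (congruence_preservingP _).1 cpt.
exact: ct.
Qed.

Variable B : nat.
Hypothesis (B_gt1 : (1 < B)%N).
Hypothesis F_all : forall k (f : operation gT k), (k <= B)%N ->
  congruence_preserving f -> Tagged (operation gT) f \in F.

Lemma expressible_small k (f : ('I_k -> gT) -> gT) :
  (0 < k <= B)%N -> compatible f -> expressible f.
Proof.
case/andP=> k0 kB cf; exists [ffun w => f (tnth w)].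
  apply: (@Generator _ _ (Tagged (operation gT) [ffun w : k.-tuple gT => f (tnth w)])).
  apply: F_all => //; apply/congruence_preservingP; split=> // N nN u v uv.
  by rewrite !ffunE; apply: cf => // i; rewrite !tnth_mktuple.
by move=> u; rewrite ffunE; apply: compatible_ext => // i; rewrite tnth_mktuple.
Qed.

(** Only the number of variables that matter counts: such a function arises by
    substituting variables in an operation with one more argument than there
    are elements in [S].  The extra argument keeps the arity positive when
    [S] is empty. *)
Lemma expressible_few k (f : ('I_k -> gT) -> gT) (S : {set 'I_k}) : (0 < k)%N ->
  (#|S| < B)%N -> compatible f -> (forall u v, {in S, u =1 v} -> f u = f v) ->
  expressible f.
Proof.
case: k f S => // k f S _ SB cf fS.
pose m := #|S|; pose s (j : 'I_m.+1) : 'I_k.+1 := nth ord0 (enum S) j.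
pose r (i : 'I_k.+1) : 'I_m.+1 := inord (index i (enum S)).
have rK i : i \in S -> s (r i) = i.
  move=> iS; rewrite /s /r inordK ?nth_index ?mem_enum //.
  by rewrite ltnS ltnW // /m cardE index_mem mem_enum.
have g1 : expressible (fun w : 'I_m.+1 -> gT => f (fun i => w (r i))).
  apply: expressible_small => //; apply: (compatible_comp cf) => i.
  exact: compatible_proj.
have := expressible_comp (n := k.+1) g1 (fun j => expressible_proj (s j)).
by apply: expressible_eq => u; apply: fS => i iS; rewrite rK.
Qed.

Lemma expressible_const k x : (0 < k)%N -> expressible (fun _ : 'I_k -> gT => x).
Proof.
move=> k0; apply: (@expressible_few _ _ set0) => //; last exact: compatible_const.
by rewrite cards0 ltnW.
Qed.

Lemma expressible_binary (h : gT -> gT -> gT) k (f g : ('I_k -> gT) -> gT) :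
  (forall N, N <| [set: gT] -> forall x x' y y', congr_mod N x x' ->
     congr_mod N y y' -> congr_mod N (h x y) (h x' y')) ->
  expressible f -> expressible g -> expressible (fun u => h (f u) (g u)).
Proof.
move=> ch gf gg.
have h2 : expressible (fun w : 'I_2 -> gT => h (w ord0) (w ord_max)).
  by apply: expressible_small => // N nN u v uv; apply: ch.
have := expressible_comp (n := k) (g := fun i : 'I_2 => if i == ord0 then f else g) h2.
by apply=> i; case: (i == ord0).
Qed.

Lemma expressibleM k (f g : ('I_k -> gT) -> gT) :
  expressible f -> expressible g -> expressible (fun u => f u * g u).
Proof. by apply: expressible_binary => N nN x x' y y'; apply: congrM. Qed.

Lemma expressibleVM k (f g : ('I_k -> gT) -> gT) :
  expressible f -> expressible g -> expressible (fun u => (f u)^-1 * g u).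
Proof.
apply: (expressible_binary (h := fun x y => x^-1 * y)) => N nN x x' y y' ? ?.
by apply: congrM => //; apply: congrV.
Qed.

(** A congruence preserving switch: it lets [t] pass exactly when [y] lies in
    the coset [g W].  Nesting such switches tests any number of variables with
    a single binary operation. *)
Definition gate (W H : {set gT}) g y t :=
  if congr_mod W g y && (t \in H) then t else 1.

(** A normal subgroup inside [W] cannot see whether the switch is open, and a
    normal subgroup above [H] contains all values of the switch; no other
    normal subgroups occur. *)
Lemma gate_congr W H g N : W <| [set: gT] -> W \subset H ->
  (N \subset W \/ H \subset N) -> forall y y' t t', congr_mod N y y' ->
  congr_mod N t t' -> congr_mod N (gate W H g y t) (gate W H g y' t').
Proof.
move=> nW WH NWH y y' t t' yy tt; rewrite /gate.
case: NWH => [NW|HN].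
  have -> : congr_mod W g y = congr_mod W g y'.
    apply/idP/idP => h; apply: (congr_trans h); last rewrite congr_sym;
    exact: congr_sub yy.
  rewrite (congr_mem (congr_sub (subset_trans NW WH) tt)).
  by case: ifP => // _; apply: congr_refl.
have gN b s : (if b && (s \in H) then s else 1) \in N.
  by case: ifP => [/andP[_ /(subsetP HN)]|]; rewrite ?group1.
by rewrite /congr_mod groupM ?groupV.
Qed.

Lemma expressible_gates W H k (g : 'I_k -> gT) (h : ('I_k -> gT) -> gT) :
  W <| [set: gT] -> W \subset H ->
  (forall N, N <| [set: gT] -> N \subset W \/ H \subset N) ->
  (0 < k)%N -> expressible h ->
  expressible (fun u => if [forall i, congr_mod W (g i) (u i)] && (h u \in H)
                      then h u else 1).
Proof.
move=> nW WH cWH k0 gh.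
pose P (s : seq 'I_k) u := all (fun i => congr_mod W (g i) (u i)) s && (h u \in H).
have gs i0 s : expressible (fun u => if P (i0 :: s) u then h u else 1).
  elim: s i0 => [|i1 s IHs] i0.
    apply: (@expressible_eq _ (fun u => gate W H (g i0) (u i0) (h u))).
      by move=> u; rewrite /gate /P /= andbT.
    apply: expressible_binary => //; last exact: expressible_proj.
    by move=> N nN *; apply: gate_congr => //; apply: cWH.
  apply: (@expressible_eq _ (fun u => gate W H (g i0) (u i0)
            (if P (i1 :: s) u then h u else 1))).
    move=> u; rewrite /gate /P /=.
    case: (boolP (h u \in H)) => hH; last by rewrite !andbF if_same.
    rewrite !andbT; case: (congr_mod W (g i0) _) => //=.
    by case: (_ && _); rewrite ?hH ?if_same.
  apply: expressible_binary => //; last exact: expressible_proj.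
  by move=> N nN *; apply: gate_congr => //; apply: cWH.
have := gs (Ordinal k0) (enum 'I_k); apply: expressible_eq => u.
rewrite /P; congr (if _ && _ then _ else _); apply/allP/forallP => [a i|a i _].
  by apply: a; rewrite inE mem_enum orbT.
exact: a.
Qed.

(** If [f] can be approximated modulo [Z] on each single coset of [W] in the
    power, it can be approximated globally: cosets are treated one by one, the
    approximation [h] being corrected by [h^-1 * h'] on the current coset and
    left alone elsewhere by means of the switches.  The two uses are [W = Z],
    for two-element intervals, and [W = H], for non-splitting ones. *)
Lemma expressible_glue Z W H k (f : ('I_k -> gT) -> gT) :
  W <| [set: gT] -> Z \subset H -> W \subset H -> (0 < k)%N ->
  (forall N, N <| [set: gT] -> N \subset W \/ H \subset N) ->
  compatible f -> (forall u, f u \in H) ->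
  (forall g : 'I_k -> gT, exists2 h, expressible h &
    forall u, (forall i, congr_mod W (g i) (u i)) -> congr_mod Z (f u) (h u)) ->
  exists2 h, expressible h & forall u, congr_mod Z (f u) (h u).
Proof.
move=> nW ZH WH k0 cWH cf fH loc.
have [h [gh _ hP]] : exists h, [/\ expressible h, forall u, h u \in H
    & forall g, g \in enum {ffun 'I_k -> gT} ->
      forall u, (forall i, congr_mod W (g i) (u i)) -> congr_mod Z (f u) (h u)].
  elim: (enum _) => [|g s [h [gh hH hP]]].
    by exists (fun=> 1); split=> //; exact: expressible_const.
  have [h' gh' h'P] := loc g.
  pose d u := (h u)^-1 * h' u.
  pose e u := if [forall i, congr_mod W (g i) (u i)] && (d u \in H) then d u else 1.
  exists (fun u => h u * e u); split.
  - by apply: expressibleM => //; apply: expressible_gates => //; apply: expressibleVM.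
  - move=> u; rewrite groupM // /e.
    by case: ifP => [/andP[]|] //; rewrite group1.
  move=> g1 g1s u ug1; rewrite /e.
  case: (boolP [forall i, congr_mod W (g i) (u i)]) => [/forallP ug|nug] /=.
    have fh' := h'P u ug.
    have h'H : h' u \in H by rewrite -(congr_mem (congr_sub ZH fh')).
    by rewrite groupM ?groupV // mulKVg.
  rewrite mulg1; move: g1s ug1; rewrite inE => /predU1P[->|g1s] ug1; last exact: hP ug1.
  by case/negP: nug; apply/forallP.
exists h => // u; apply: (hP [ffun i => u i]); first by rewrite mem_enum.
by move=> i; rewrite ffunE; apply: congr_refl.
Qed.

End Generation.

(** * Non-splitting intervals *)

Section NonSplitting.
Local Open Scope group_scope.
Variable gT : finGroupType.
Implicit Types (A N W Z H K : {group gT}) (x y m : gT).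

(** The negation of splitting in the positive form that the proofs use, for a
    proposed pair [D < H], [E > Z]. *)
Definition non_splitting (Z H : {group gT}) :=
  forall D E : {group gT}, D <| [set: gT] -> E <| [set: gT] ->
    Z \subset D -> D \subset H -> Z \subset E -> E \subset H ->
    ~~ (H \subset D) -> ~~ (E \subset Z) ->
  exists A : {group gT}, [/\ A <| [set: gT], Z \subset A, A \subset H,
    ~~ (A \subset D) & ~~ (E \subset A)].

Definition update k (u : 'I_k -> gT) l x := fun i => if i == l then x else u i.

(** The heart of the sufficiency.  Let [f] take values in [K] and vanish modulo
    [Z] as soon as one variable in [S] is 1.  If [A] does not contain [K] then
    changing one variable [l] of [S] by an element of [A] changes [f] by an
    element of the smaller group [K :&: A], and this difference vanishes as
    soon as one variable in [S :\ l] is 1.  By induction on the size of [K]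
    the difference is trivial modulo [Z].  As the interval does not split,
    such groups [A] generate [H], so [f] does not depend on the variable [l]
    modulo [Z], and it vanishes where that variable is 1. *)
Lemma absorbing_trivial Z H : Z <| [set: gT] -> non_splitting Z H ->
  forall n K, K <| [set: gT] -> Z \subset K -> K \subset H -> (#|K| <= n)%N ->
  forall k (f : ('I_k -> gT) -> gT) (S : {set 'I_k}),
    compatible f -> (n <= #|S|)%N ->
    (forall u, (forall i, u i \in H) -> f u \in K) ->
    (forall l u, l \in S -> (forall i, u i \in H) -> u l = 1 -> f u \in Z) ->
  forall u, (forall i, u i \in H) -> f u \in Z.
Proof.
move=> nZ nsZH; elim=> [|n IHn] K nK ZK KH; first by rewrite leqNgt cardG_gt0.
move=> Kn k f S cf nS fK f0.
have [KZ|KZ] := boolP (K \subset Z); first by move=> u /fK; apply: (subsetP KZ).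
have /card_gt0P[l lS] : (0 < #|S|)%N by apply: leq_trans nS.
pose D m (u : 'I_k -> gT) := congr_mod Z (f u) (f (update u l (u l * m))).
(* [M] collects the translations of the variable [l] that leave [f] fixed
   modulo [Z]; the non-splitting condition speaks about normal subgroups, hence
   the core [C] of [M]. *)
pose M := [set m in H | [forall u : {ffun 'I_k -> gT},
            [forall i, u i \in H] ==> D m u]].
have DE m u v : u =1 v -> D m u = D m v.
  move=> uv; rewrite /D (compatible_ext cf uv); congr congr_mod.
  by apply: (compatible_ext cf) => i; rewrite /update uv uv.
have MP m : reflect (m \in H /\ forall u, (forall i, u i \in H) -> D m u) (m \in M).
  rewrite inE; apply: (iffP andP) => -[mH mD]; split=> //.
    move=> u uH; have /forallP/(_ [ffun i => u i])/implyP := mD.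
    rewrite (DE _ _ u) => [-> //|i]; last by rewrite ffunE.
    by apply/forallP=> i; rewrite ffunE.
  by apply/forallP=> u; apply/implyP=> /forallP; apply: mD.
have upH u x : (forall i, u i \in H) -> x \in H -> forall i, update u l x i \in H.
  by move=> uH xH i; rewrite /update; case: ifP.
have gM : group_set M.
  apply/group_setP; split=> [|m m' /MP[mH mD] /MP[m'H m'D]]; apply/MP; split.
  - exact: group1.
  - move=> u uH; rewrite /D.
    rewrite (@compatible_ext _ _ _ (update u l (u l * 1)) u cf) ?congr_refl //.
    by move=> i; rewrite /update mulg1; case: eqP => // ->.
  - exact: groupM.
  move=> u uH; apply: congr_trans (mD u uH) _.
  have := m'D (update u l (u l * m)) (upH _ _ uH (groupM (uH l) mH)).
  rewrite /D; congr congr_mod; apply: (compatible_ext cf) => i.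
  by rewrite /update eqxx -mulgA; case: eqP.
have MH : M \subset H by apply/subsetP=> m /MP[].
pose C : {group gT} := [group of gcore (Group gM) [set: gT]].
have nC : C <| [set: gT] by apply: gcore_normal; apply: subsetT.
have CM : C \subset M := gcore_sub _ _.
have inM A : A <| [set: gT] -> Z \subset A -> A \subset H -> ~~ (K \subset A) ->
    A \subset C.
  move=> nA ZA AH KA; apply: gcore_max; last exact: normal_norm.
  apply/subsetP=> m mA; apply/MP; split; first exact: (subsetP AH).
  have nKA : (K :&: A)%G <| [set: gT] := normalI nK nA.
  have mH := subsetP AH _ mA.
  apply: (IHn _ nKA _ _ _ k (fun u => (f u)^-1 * f (update u l (u l * m))) (S :\ l)).
  - by rewrite subsetI ZK.
  - by rewrite subIset // KH.
  - rewrite -ltnS; apply: leq_trans Kn; apply: proper_card.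
    by rewrite properE subsetIl /= subsetI subxx.
  - apply: compatibleM; first exact: compatibleV.
    apply: (compatible_comp (g := fun i u => update u l (u l * m) i)) => // i.
    rewrite /update; case: (i == l); last exact: compatible_proj.
    by apply: compatibleM; [apply: compatible_proj|apply: compatible_const].
  - by move: nS; rewrite (cardsD1 l S) lS.
  - move=> u uH; have uH' := upH _ _ uH (groupM (uH l) mH).
    rewrite inE groupM ?groupV ?fK //=; apply: cf => // i.
    by rewrite /update; case: eqP => [->|_]; rewrite /congr_mod ?mulKg ?mulVg.
  move=> i u; rewrite !inE => /andP[il iS] uH ui.
  have uH' := upH _ _ uH (groupM (uH l) mH).
  rewrite groupM ?groupV //; apply: (f0 i) => //.
  by rewrite /update (negPf il).
have HC : H \subset C.
  apply/negPn/negP => nHC.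
  have CH : C \subset H := subset_trans CM MH.
  have ZC : Z \subset C by apply: inM; rewrite ?subxx // (subset_trans ZK).
  have [A [nA ZA AH AC KA]] := nsZH C K nC nK ZC CH ZK KH nHC KZ.
  by rewrite inM in AC.
move=> u uH; have /MP[_] : u l \in M by apply: (subsetP CM); apply: (subsetP HC).
have u1H := upH _ _ uH (group1 H).
move=> /(_ _ u1H); rewrite /D.
rewrite [X in congr_mod _ _ X](@compatible_ext _ _ _ _ u cf) => [|i]; last first.
  by rewrite /update eqxx mul1g; case: eqP => // ->.
move=> /congr_mem <-; apply: (f0 l) => //; by rewrite /update eqxx.
Qed.

Variables (F : seq (any_operation gT)) (B : nat).
Hypothesis F_cp : forall f, f \in F -> congruence_preserving (tagged f).
Hypothesis (B_gt1 : (1 < B)%N).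
Hypothesis F_all : forall k (f : operation gT k), (k <= B)%N ->
  congruence_preserving f -> Tagged (operation gT) f \in F.

Definition restrict k (S : {set 'I_k}) (u : 'I_k -> gT) :=
  fun i => if i \in S then u i else 1.

Lemma restrict_restrict k (S T : {set 'I_k}) u :
  restrict S (restrict T u) =1 restrict (S :&: T) u.
Proof. by move=> i; rewrite /restrict inE; case: (i \in S); case: (i \in T). Qed.

(** On the power of [H], a compatible function is modulo [Z] the product, over
    all sets [S] of variables, of corrections that depend on the variables in
    [S] only and vanish when one of these is 1.  By [absorbing_trivial] the
    corrections belonging to large [S] are trivial, so operations of bounded
    arity suffice. *)
Lemma expressible_non_splitting Z H k (f : ('I_k -> gT) -> gT) :
  Z <| [set: gT] -> H <| [set: gT] -> Z \subset H -> non_splitting Z H ->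
  (#|H| < B)%N -> (0 < k)%N -> compatible f ->
  (forall u, (forall i, u i \in H) -> f u \in H) ->
  exists2 h, expressible F h &
    forall u, (forall i, u i \in H) -> congr_mod Z (f u) (h u).
Proof.
move=> nZ nH ZH nsZH HB k0 cf fH.
have rH (S : {set 'I_k}) u : (forall i, u i \in H) -> forall i, restrict S u i \in H.
  by move=> uH i; rewrite /restrict; case: ifP.
suff [h [gh _ hP]] : exists h, [/\ expressible F h,
    forall u, (forall i, u i \in H) -> h u \in H & forall S, S \in [set: {set 'I_k}] ->
    forall u, (forall i, u i \in H) -> congr_mod Z (f (restrict S u)) (h (restrict S u))].
  exists h => // u uH; have := hP setT (in_setT _) u uH.
  have uE : restrict setT u =1 u by move=> i; rewrite /restrict inE.
  by rewrite (compatible_ext cf uE) (compatible_ext (expressible_compatible F_cp gh) uE).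
(* The sets [S] are added in such an order that the sets treated at each stage
   form a family [D] closed under taking subsets. *)
have: (forall S T : {set 'I_k}, S \in [set: {set 'I_k}] -> T \subset S ->
         T \in [set: {set 'I_k}]) by move=> *; rewrite inE.
move: {2}#|_| (leqnn #|[set: {set 'I_k}]|) => n; elim: n [set: _] => [|n IHn] D.
  rewrite leqn0 cards_eq0 => /eqP-> _; exists (fun=> 1); split.
  - exact: (expressible_const B_gt1 F_all).
  - by move=> u _; apply: group1.
  by move=> S; rewrite inE.
have [->|/set0Pn[S0 S0D]] := eqVneq D set0.
  by rewrite cards0 => _ /IHn; rewrite cards0; apply.
move=> Dn dD; case: (arg_maxnP (fun S : {set 'I_k} => #|S|) S0D) => S SD Smax.
have {}SD : S \in D := SD.
have [|S1 T|h [gh hH hP]] := IHn (D :\ S).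
- by move: Dn; rewrite (cardsD1 S D) SD.
- rewrite !inE => /andP[S1S S1D] TS1; rewrite (dD _ _ S1D TS1) andbT.
  by apply: contraNneq S1S => TS; rewrite eq_sym eqEcard -TS TS1 TS; apply: Smax.
have ch := expressible_compatible F_cp gh.
pose e u := (h u)^-1 * f u.
have ce : compatible e by apply: compatibleM => //; apply: compatibleV.
have eZ T u : T \in D -> T != S -> (forall i, u i \in H) -> e (restrict T u) \in Z.
  move=> TD TS uH; have := hP T; rewrite !inE TD TS => /(_ isT u uH).
  by rewrite congr_sym.
have eSZ T u : T \in D -> T != S -> (forall i, u i \in H) ->
    e (restrict S (restrict T u)) \in Z.
  move=> TD TS uH; rewrite (compatible_ext ce (restrict_restrict _ _ _)).
  apply: eZ => //; first by apply: (dD T) => //; apply: subsetIr.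
  apply: contraNneq TS => /setIidPl ST.
  by rewrite eq_sym eqEcard ST; apply: Smax.
have eH u : (forall i, u i \in H) -> e (restrict S u) \in H.
  by move=> uH; rewrite groupM ?groupV ?hH ?fH //; apply: rH.
have [SB|BS] := ltnP #|S| B.
  exists (fun u => h u * e (restrict S u)); split.
  - apply: (expressibleM B_gt1 F_all) => //.
    apply: (expressible_few F_all (S := S)) => //.
      apply: (compatible_comp (g := fun i u => restrict S u i)) => // i.
      rewrite /restrict; case: (i \in S); first exact: compatible_proj.
      exact: compatible_const.
    move=> u v uv; apply: (compatible_ext ce) => i.
    by rewrite /restrict; case: ifP => // /uv.
  - by move=> u uH; rewrite groupM ?eH ?hH.
  move=> T TD u uH; have [->|TS] := eqVneq T S.
    rewrite (compatible_ext ce (restrict_restrict _ _ _)) setIid /e mulKVg.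
    exact: congr_refl.
  rewrite -[X in congr_mod _ X]mulg1 congrM //; first by apply: hP; rewrite ?inE ?TS.
  by rewrite congr_from1; apply: eSZ.
exists h; split=> // T TD u uH.
have [->|TS] := eqVneq T S; last by apply: hP; rewrite ?inE ?TS.
rewrite congr_sym.
apply: (absorbing_trivial nZ nsZH nH ZH (subxx _) (leqnn _)
  (f := fun u => e (restrict S u)) (S := S)) => //.
- apply: (compatible_comp (g := fun i u => restrict S u i)) => // i.
  rewrite /restrict; case: (i \in S); first exact: compatible_proj.
  exact: compatible_const.
- exact: leq_trans (ltnW HB) BS.
move=> l v lS vH vl.
have -> : e (restrict S v) = e (restrict (S :\ l) v).
  apply: (compatible_ext ce) => i; rewrite /restrict !inE.
  by case: eqP => //= ->; rewrite lS.
apply: eZ => //; first by apply: (dD S) => //; apply: subsetDl.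
by apply: contraTneq lS => <-; rewrite !inE eqxx.
Qed.

End NonSplitting.

(** * Normal subgroups of p-groups *)

Section PGroupLattice.
Local Open Scope group_scope.
Variables (p : nat) (gT : finGroupType).
Hypotheses (p_prime : prime p) (pG : p.-group [set: gT]).
Implicit Types (A B C D E N W X Y Z H K : {group gT}) (x y : gT).

Lemma subT_norm N (A : {set gT}) : N <| [set: gT] -> A \subset 'N(N).
Proof. by move=> /normal_norm; apply: subset_trans; apply: subsetT. Qed.

Lemma cosetpre_normalT N (Q : {group coset_of N}) : N <| [set: gT] ->
  Q <| [set: coset_of N] -> coset N @*^-1 Q <| [set: gT].
Proof.
move=> nN; rewrite -cosetpre_normal; congr (is_true (_ <| _)).
by rewrite morphpreT; apply/eqP; rewrite eqEsubset subsetT subT_norm.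
Qed.

(** The quotient by [A] is a p-group, so its normal subgroup [B / A] contains
    normal subgroups of all orders that Lagrange's theorem allows. *)
Lemma normal_between A B (r : nat) : A <| [set: gT] -> B <| [set: gT] ->
  A \subset B -> r <= logn p #|B : A| ->
  exists C : {group gT},
    [/\ C <| [set: gT], A \subset C, C \subset B & #|C : A| = (p ^ r)%N].
Proof.
move=> nA nB AB rAB; have sN := subT_norm _ nA.
have pQ : p.-group [set: coset_of A] by rewrite -quotientT quotient_pgroup.
have nQ : B / A <| [set: coset_of A] by rewrite -quotientT quotient_normal.
have [|Q [QB nQT cQ]] := normal_pgroup (r := r) pQ nQ.
  by rewrite card_quotient ?sN.
exists (coset A @*^-1 Q)%G; split.
- exact: cosetpre_normalT.
- exact: sub_cosetpre.
- by rewrite -(quotientSGK (sN _) AB) /= cosetpreK.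
by rewrite -card_quotient ?sN //= cosetpreK.
Qed.

Lemma logn_index A B : A \subset B -> #|B : A| = (p ^ logn p #|B : A|)%N.
Proof.
move=> AB; have pB : p.-group B := pgroupS (subsetT _) pG.
have /p_natP[e ->] : p.-nat #|B : A| by apply: pnat_dvd (dvdn_indexg _ _) pB.
by rewrite pfactorK.
Qed.

Lemma logn_index_gt0 A B : A \subset B -> ~~ (B \subset A) -> 0 < logn p #|B : A|.
Proof.
move=> AB nBA; rewrite lt0n; apply: contraNneq nBA => l0.
by rewrite -indexg_eq1 (logn_index AB) l0.
Qed.

Lemma cover_above A B : A <| [set: gT] -> B <| [set: gT] ->
  A \subset B -> ~~ (B \subset A) ->
  exists C : {group gT}, [/\ C <| [set: gT], A \subset C, C \subset B & #|C : A| = p].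
Proof.
move=> nA nB AB nBA.
by have [C []] := normal_between nA nB AB (logn_index_gt0 AB nBA); exists C.
Qed.

Lemma cover_below A B : A <| [set: gT] -> B <| [set: gT] ->
  A \subset B -> ~~ (B \subset A) ->
  exists C : {group gT}, [/\ C <| [set: gT], A \subset C, C \subset B & #|B : C| = p].
Proof.
move=> nA nB AB nBA; have l0 := logn_index_gt0 AB nBA.
have [C [nC AC CB iC]] := normal_between nA nB AB (leq_pred _).
exists C; split=> //; apply/eqP.
rewrite -(eqn_pmul2r (indexg_gt0 C A)) Lagrange_index // iC -expnS prednK //.
by rewrite (logn_index AB) pfactorK.
Qed.

Lemma prime_normal_central (qT : finGroupType) (A : {group qT}) :
  p.-group [set: qT] -> A <| [set: qT] -> #|A| = p -> A \subset 'Z([set: qT]).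
Proof.
move=> pQ nA cA; apply: prime_meetG; first by rewrite cA.
apply: meet_center_nil => //; first exact: pgroup_nil pQ.
by rewrite -cardG_gt1 cA prime_gt1.
Qed.

(** Two distinct normal subgroups of order [p] are central, so their product is
    elementary abelian of rank two and every line in it is normal.  This is the
    property of p-groups that fails for general finite groups. *)
Lemma diagonal_central (qT : finGroupType) (A B : {group qT}) :
  p.-group [set: qT] -> A <| [set: qT] -> B <| [set: qT] ->
  #|A| = p -> #|B| = p -> A :&: B = 1 ->
  exists C : {group qT}, [/\ C <| [set: qT], C \subset A <*> B,
    C :&: A = 1 /\ C :&: B = 1, A \subset C <*> B & B \subset C <*> A].
Proof.
move=> pQ nA nB cA cB AB1.
have /subsetP zA := prime_normal_central pQ nA cA.
have /subsetP zB := prime_normal_central pQ nB cB.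
have /cyclicP[a Aa] : cyclic A by rewrite prime_cyclic // cA.
have /cyclicP[b Bb] : cyclic B by rewrite prime_cyclic // cB.
have oa : #[a] = p by rewrite orderE -Aa.
have ob : #[b] = p by rewrite orderE -Bb.
have aA : a \in A by rewrite Aa cycle_id.
have bB : b \in B by rewrite Bb cycle_id.
have cab : commute a b by have /centerP[_] := zA a aA; apply; rewrite inE.
have cycM n : (a * b) ^+ n = a ^+ n * b ^+ n by apply: expgMn.
have AB (x : qT) : x \in A -> x \in B -> x = 1.
  by move=> xA xB; apply/set1gP; rewrite -AB1 inE xA.
exists <[a * b]>%G; split.
- by apply: sub_center_normal; rewrite cycle_subG groupM ?(zA a) ?(zB b).
- by rewrite cycle_subG groupM // mem_gen // inE ?aA ?bB ?orbT.
- split; apply/trivgP/subsetP=> x /setIP[/cycleP[n ->]]; rewrite cycM => h.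
    have bn1 : b ^+ n = 1.
      by apply: AB; [rewrite -(groupMl (b ^+ n) (groupX n aA))|apply: groupX].
    rewrite bn1 mulg1; move/eqP: bn1; rewrite -order_dvdn ob -oa order_dvdn => /eqP->.
    exact: group1.
  have an1 : a ^+ n = 1.
    by apply: AB; [apply: groupX|rewrite -(groupMr (a ^+ n) (groupX n bB))].
  rewrite an1 mul1g; move/eqP: an1; rewrite -order_dvdn oa -ob order_dvdn => /eqP->.
  exact: group1.
- have bJ : b \in <[a * b]> <*> B by rewrite mem_gen // inE bB orbT.
  by rewrite {1}Aa cycle_subG -(groupMr a bJ) mem_gen // inE cycle_id.
have aJ : a \in <[a * b]> <*> A by rewrite mem_gen // inE aA orbT.
by rewrite {1}Bb cycle_subG -(groupMl b aJ) mem_gen // inE cycle_id.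
Qed.

Lemma diagonal X A B : X <| [set: gT] -> A <| [set: gT] -> B <| [set: gT] ->
  X \subset A -> X \subset B -> #|A : X| = p -> #|B : X| = p ->
  A :&: B \subset X ->
  exists C : {group gT}, [/\ C <| [set: gT], X \subset C, C \subset A <*> B,
    C :&: A \subset X /\ C :&: B \subset X & A \subset C <*> B /\ B \subset C <*> A].
Proof.
move=> nX nA nB XA XB iA iB ABX; have sN (S : {set gT}) := subT_norm S nX.
have pQ : p.-group [set: coset_of X] by rewrite -quotientT quotient_pgroup.
have nQ N : N <| [set: gT] -> N / X <| [set: coset_of X].
  by move=> nN; rewrite -quotientT quotient_normal.
have [|||C [nC CAB [CA1 CB1] ACB BCA]] :=
    diagonal_central (A := A / X) (B := B / X) pQ (nQ _ nA) (nQ _ nB).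
- by rewrite card_quotient.
- by rewrite card_quotient.
- by apply/trivgP; rewrite /= -quotientGI // quotient_sub1.
have XC : X \subset coset X @*^-1 C := sub_cosetpre _.
have XJ (S : {set gT}) K : X \subset K -> X \subset K <*> S.
  by move=> XK; apply: subset_trans XK (joing_subl _ _).
exists (coset X @*^-1 C)%G; split=> //.
- exact: cosetpre_normalT.
- by rewrite -(quotientSGK (sN _) (XJ _ _ XA)) /= quotientY // cosetpreK.
- by split; rewrite -quotient_sub1 //= quotientGI //= cosetpreK ?CA1 ?CB1.
by split; rewrite -(quotientSGK (sN _) (XJ _ (coset X @*^-1 C)%G XC)) /=
  quotientY // cosetpreK.
Qed.

(** The sublattice [X < B, Y, W < B <*> Y] with three pairwise complementary
    middle elements, inside the interval from [Z] to [H]. *)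
Definition diamond_through Z H B X Y W : Prop :=
  [/\ [/\ X <| [set: gT], Y <| [set: gT] & W <| [set: gT]],
      [/\ Z \subset X, X \subset B, X \subset Y & X \subset W],
      [/\ B <*> Y \subset H, #|B <*> Y : B| = p & ~~ (B \subset X)],
      [/\ B :&: Y \subset X, W :&: B \subset X & W :&: Y \subset X]
    & [/\ W \subset B <*> Y, B \subset W <*> Y & Y \subset W <*> B]].

(** If [E] is incomparable with [B], pick [D] of index [p] over [B :&: E] inside
    [E], and [X] of index [p] below [B] above [B :&: E].  By modularity [B] and
    [Y = X <*> D] are distinct of index [p] over [X], and a diagonal completes
    the diamond. *)
Lemma diamond Z H B E : B <| [set: gT] -> E <| [set: gT] ->
    Z \subset B -> B \subset H -> Z \subset E -> E \subset H ->
    ~~ (B \subset E) -> ~~ (E \subset B) ->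
  exists X Y W, diamond_through Z H B X Y W.
Proof.
move=> nB nE ZB BH ZE EH nBE nEB.
have nA : B :&: E <| [set: gT] := normalI nB nE.
have [D [nD AD DE iD]] : exists D : {group gT}, [/\ D <| [set: gT],
    B :&: E \subset D, D \subset E & #|D : B :&: E| = p].
  by apply: (@cover_above (B :&: E)%G E); rewrite ?subsetIr // subsetI (negPf nEB).
have [X [nX AX XB iX]] : exists X : {group gT}, [/\ X <| [set: gT],
    B :&: E \subset X, X \subset B & #|B : X| = p].
  by apply: (@cover_below (B :&: E)%G B); rewrite ?subsetIl // subsetI subxx (negPf nBE).
have nY : X <*> D <| [set: gT] := normalY nX nD.
have BD : B :&: D = B :&: E.
  by apply/eqP; rewrite eqEsubset setIS //= subsetI subsetIl AD.
have BY : (X <*> D) :&: B = X.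
  rewrite norm_joinEl ?subT_norm // -group_modl // setIC BD.
  by rewrite mulGSid.
have iY : #|X <*> D : X| = p.
  have DX : D :&: X = B :&: E.
    by apply/eqP; rewrite eqEsubset -{1}BD setIC setSI //= subsetI AD AX.
  by rewrite /= norm_joinEl ?subT_norm // indexMg -indexgI DX.
have iBY : #|B <*> (X <*> D) : B| = p.
  rewrite (@norm_joinEl _ B (X <*> D)%G) ?subT_norm // indexMg -[RHS]iY -indexgI /=.
  by rewrite BY.
have [W [nW XW WBY [WB WY] [BWY YWB]]] : exists C : {group gT}, [/\ C <| [set: gT],
    X \subset C, C \subset B <*> (X <*> D),
    C :&: B \subset X /\ C :&: (X <*> D) \subset X
    & B \subset C <*> (X <*> D) /\ X <*> D \subset C <*> B].
  apply: (diagonal (B := (X <*> D)%G)) => //; first exact: joing_subl.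
  by rewrite setIC BY.
exists X, (X <*> D)%G, W; split; split=> //.
- by apply: subset_trans AX; rewrite subsetI ZB.
- exact: joing_subl.
- by rewrite join_subG BH join_subG (subset_trans XB) // (subset_trans DE).
- apply/negP => BX; have := prime_gt1 p_prime; rewrite -iX.
  by rewrite (eqP (_ : #|B : X| == 1)%N) // indexg_eq1.
by rewrite setIC BY.
Qed.

End PGroupLattice.

(** * Central sections *)

Section Central.
Local Open Scope group_scope.
Variables (gT : finGroupType) (H : {group gT}).
Implicit Types (A B C D E N W X Y Z : {group gT}).

(** The section [B / A] is central over [H]: the effect, modulo [A], of
    translating the arguments of [f] by elements of [B] is the same at any two
    points that differ by elements of [H].  For [f] the group multiplication
    this yields [[H, B] <= A]. *)
Definition central_section A B :=
  forall k (f : ('I_k -> gT) -> gT), compatible f -> forall g x y : 'I_k -> gT,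
    (forall i, x i \in H) -> (forall i, y i \in B) ->
    congr_mod A ((f g)^-1 * f (fun i => g i * y i))
      ((f (fun i => g i * x i))^-1 * f (fun i => g i * x i * y i)).

Lemma joing_factor k A B (u : 'I_k -> gT) : A <| [set: gT] ->
  (forall i, u i \in B <*> A) ->
  exists b a : 'I_k -> gT, [/\ forall i, b i \in B, forall i, a i \in A
    & forall i, u i = b i * a i].
Proof.
move=> nA uBA.
have /fin_all_exists2[b bB bP] : forall i, exists2 b, b \in B & b^-1 * u i \in A.
  move=> i; have := uBA i; rewrite norm_joinEl ?subT_norm // => /mulsgP[b a bB aA ->].
  by exists b; rewrite ?mulKg.
exists b, (fun i => (b i)^-1 * u i); split=> // i; by rewrite mulKVg.
Qed.

Lemma congr_mulr N x a : a \in N -> congr_mod N x (x * a).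
Proof. by rewrite /congr_mod mulKg. Qed.

(** Centrality is invariant under transposition of sections, here upwards and
    below downwards. *)
Lemma central_up A B C D : C <| [set: gT] ->
  A \subset C -> D \subset B <*> C -> central_section A B -> central_section C D.
Proof.
move=> nC AC DBC cAB k f cf g x y xH yD.
have [|b [c [bB cC E]]] := joing_factor (u := y) nC (B := B).
  by move=> i; apply: (subsetP DBC).
have e (v : 'I_k -> gT) : congr_mod C (f (fun i => v i * y i)) (f (fun i => v i * b i)).
  by apply: cf => // i; rewrite E mulgA congr_sym congr_mulr.
have cV (a b1 b2 : gT) : congr_mod C b1 b2 -> congr_mod C (a^-1 * b1) (a^-1 * b2).
  by move=> h; apply: congrM => //; apply: congr_refl.
apply: congr_trans (cV _ _ _ (e _)) _.
apply: congr_trans (congr_sub AC (cAB k f cf g x b xH bB)) _.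
by rewrite congr_sym; apply: cV; apply: e.
Qed.

Lemma central_down A B C D : B <| [set: gT] ->
  B \subset D -> B :&: C \subset A -> central_section C D -> central_section A B.
Proof.
move=> nB BD BCA cCD k f cf g x y xH yB; apply: (subsetP BCA); rewrite inE.
have fB v : (f v)^-1 * f (fun i => v i * y i) \in B.
  by apply: cf => // i; apply: congr_mulr.
rewrite groupM ?groupV ?fB //=; apply: cCD => // i; exact: (subsetP BD).
Qed.

(** The two differences to be compared lie in [B], since [f] preserves [B], and
    are congruent modulo [C], since [f] preserves [C]. *)
Lemma central_shift A B C k (f : ('I_k -> gT) -> gT) (g x y : 'I_k -> gT) :
  A <| [set: gT] -> B <| [set: gT] -> C <| [set: gT] ->
  C :&: B \subset A -> compatible f ->
  (forall i, x i \in C) -> (forall i, y i \in B) ->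
  congr_mod A ((f g)^-1 * f (fun i => g i * y i))
    ((f (fun i => g i * x i))^-1 * f (fun i => g i * x i * y i)).
Proof.
move=> nA nB nC CBA cf xC yB.
have fB v : (f v)^-1 * f (fun i => v i * y i) \in B.
  by apply: cf => // i; apply: congr_mulr.
apply: (subsetP CBA); rewrite inE [X in _ && X]groupM ?groupV ?fB // andbT.
rewrite -/(congr_mod _ _ _); apply: congrM => //; last first.
  apply: cf => // i; rewrite /congr_mod invMg -!mulgA mulKg.
  by rewrite -conjgE memJ_norm // (subsetP (subT_norm [set: gT] nC)) ?inE.
by apply: congrV => //; apply: cf => // i; apply: congr_mulr.
Qed.

Lemma central_of_two A B C D :
  A <| [set: gT] -> B <| [set: gT] -> C <| [set: gT] -> D <| [set: gT] ->
  C :&: B \subset A -> D :&: B \subset A -> H \subset C <*> D ->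
  central_section A B.
Proof.
move=> nA nB nC nD CB DB HCD k f cf g x y xH yB.
have [|c [d [cC dD E]]] := joing_factor (u := x) nD (B := C).
  by move=> i; apply: (subsetP HCD).
apply: congr_trans (central_shift g nA nB nC CB cf cC yB) _.
have := central_shift (fun i => g i * c i) nA nB nD DB cf dD yB.
congr (congr_mod _ _ (_^-1 * _)); apply: (compatible_ext cf) => i;
  by rewrite E !mulgA.
Qed.

Variable p : nat.
Hypotheses (p_prime : prime p) (pG : p.-group [set: gT]).
Variable Z : {group gT}.
Hypotheses (nZ : Z <| [set: gT]) (nH : H <| [set: gT]).
Hypothesis cutZ : forall N, N <| [set: gT] -> N \subset Z \/ Z \subset N.
Hypothesis cutH : forall N, N <| [set: gT] -> N \subset H \/ H \subset N.
Hypothesis no_cut : forall B, B <| [set: gT] -> Z \subset B -> B \subset H ->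
  ~~ (B \subset Z) -> ~~ (H \subset B) ->
  exists E, [/\ E <| [set: gT], ~~ (B \subset E) & ~~ (E \subset B)].
Hypothesis not_two : exists C, [/\ C <| [set: gT], Z \subset C, C \subset H,
  ~~ (C \subset Z) & ~~ (H \subset C)].

Lemma diamond_no_cut B : B <| [set: gT] -> Z \subset B -> B \subset H ->
  ~~ (B \subset Z) -> ~~ (H \subset B) ->
  exists X Y W, diamond_through p Z H B X Y W.
Proof.
move=> nB ZB BH nBZ nHB; have [E [nE nBE nEB]] := no_cut nB ZB BH nBZ nHB.
apply: (diamond p_prime pG nB nE) => //.
  by case: (cutZ nE) => // EZ; rewrite (subset_trans EZ ZB) in nEB.
by case: (cutH nE) => // HE; rewrite (subset_trans BH HE) in nBE.
Qed.

Lemma index_prime_eq A C D : A \subset C -> C \subset D -> #|D : A| = p ->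
  #|C : A| = p -> D \subset C.
Proof.
move=> AC CD iD iC; rewrite -indexg_eq1 -(eqn_pmul2r (prime_gt0 p_prime)) mul1n.
by rewrite -{1}iC Lagrange_index // iD.
Qed.

(** A normal subgroup [A] of index [p] below [H] does not cut the lattice, so it
    lies in a diamond with top [H].  There [A] and [W] meet [Y] in the bottom and
    generate [H], which makes the section [Y / X] central; transposing it
    upwards gives [H / A]. *)
Lemma central_top : exists A, [/\ A <| [set: gT], Z \subset A, A \subset H,
  ~~ (H \subset A) & central_section A H].
Proof.
have [C [nC ZC CH nCZ nHC]] := not_two.
have [A [nA CA AH iA]] := cover_below p_prime pG nC nH CH nHC.
have nHA : ~~ (H \subset A).
  by rewrite -indexg_eq1 iA; case: eqP p_prime => // ->.
have nAZ : ~~ (A \subset Z) by apply: contra nCZ; apply: subset_trans.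
have ZA := subset_trans ZC CA.
have [X [Y [W [[nX nY nW] [ZX XA XY XW] [zH iz nAX] [AYX WAX WYX] [Wz AWY YWA]]]]] :=
  diamond_no_cut nA ZA AH nAZ nHA.
have Hz : H \subset A <*> Y.
  exact: (index_prime_eq (C := (A <*> Y)%G) (joing_subl _ _) zH iA iz).
exists A; split=> //; apply: (central_up (A := X) (B := Y)) => //.
  by rewrite joingC.
apply: (central_of_two (C := W) (D := A)) => //.
by apply: subset_trans Hz _; rewrite join_subG YWA joing_subr.
Qed.

(** Centrality spreads downwards from the top: let [B < H], and take the diamond
    through [B], with top [B <*> Y].  By induction a section [(B <*> Y) / A] is
    central.  Either [B] is not below [A] and transposing downwards gives a
    section with top [B]; or [A = B], and the section travels
    [(B <*> Y) / B], [W / X], [(B <*> Y) / Y], [B / X] through the diamond. *)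
Lemma central_series B : B <| [set: gT] -> Z \subset B -> B \subset H ->
  ~~ (B \subset Z) -> exists A, [/\ A <| [set: gT], Z \subset A, A \subset B,
  #|B : A| = p & central_section A B].
Proof.
suff main B1 : B1 <| [set: gT] -> Z \subset B1 -> B1 \subset H ->
  ~~ (B1 \subset Z) -> exists A, [/\ A <| [set: gT], Z \subset A, A \subset B1,
  ~~ (B1 \subset A) & central_section A B1].
  move=> nB ZB BH nBZ; have [X [nX ZX XB nBX cXB]] := main B nB ZB BH nBZ.
  have [A [nA XA AB iA]] := cover_below p_prime pG nX nB XB nBX.
  exists A; split=> //; first exact: subset_trans XA.
  by apply: central_up cXB => //; apply: joing_subl.
move: {2}#|H : B1| (leqnn #|H : B1|) => n; elim: n B1 => [|n IHn] {}B.
  by rewrite leqn0 -[_ == 0%N]negbK -lt0n indexg_gt0.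
move=> Bn nB ZB BH nBZ; have [HB|nHB] := boolP (H \subset B).
  have -> : B = H by apply/group_inj/eqP; rewrite eqEsubset BH.
  exact: central_top.
have [X [Y [W [[nX nY nW] [ZX XB XY XW] [zH iz nBX] [BYX WBX WYX] [Wz BWY YWB]]]]] :=
  diamond_no_cut nB ZB BH nBZ nHB.
have nz : (B <*> Y)%G <| [set: gT] := normalY nB nY.
have Bz : B \subset (B <*> Y)%G := joing_subl _ _.
have [||||A [nA ZA Az nzA cA]] := IHn (B <*> Y)%G _ nz.
- rewrite -ltnS; apply: leq_trans Bn; rewrite -(Lagrange_index zH Bz) iz.
  by rewrite ltn_Pmulr ?prime_gt1 // indexg_gt0.
- exact: subset_trans Bz.
- exact: zH.
- by apply: contra nBZ; apply: subset_trans.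
have [BA|nBA] := boolP (B \subset A); last first.
  exists (A :&: B)%G; split.
  - exact: normalI.
  - by rewrite subsetI ZA.
  - exact: subsetIr.
  - by rewrite subsetI negb_and nBA.
  by apply: (central_down nB Bz _ cA); rewrite /= setIC.
have AB : A \subset B.
  rewrite -indexg_eq1; have := iz; rewrite -(Lagrange_index Az BA) => h.
  have nzA1 : #|B <*> Y : A| != 1%N by rewrite indexg_eq1.
  have iA : #|B <*> Y : A| = p.
    by apply/(prime_nt_dvdP p_prime nzA1); rewrite -h dvdn_mulr.
  by rewrite -(eqn_pmul2l (prime_gt0 p_prime)) -{1}iA h muln1.
have cB : central_section B (B <*> Y)%G by apply: central_up cA => //; apply: joing_subl.
have cXW := central_down nW Wz WBX cB.
have cY : central_section Y (B <*> Y)%G.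
  by apply: (central_up nY XY _ cXW); rewrite join_subG BWY joing_subr.
by exists X; split=> //; apply: (central_down nB Bz BYX cY).
Qed.

End Central.

(** * Degrees on the Boolean cube *)

Section Degree.
Import GRing.Theory.
Local Open Scope ring_scope.
Variables (R : comNzRingType) (I : finType).
Implicit Types (u v : {set I} -> R) (S T U : {set I}) (d e : nat).

(** Functions on a finite Boolean cube that are polynomials of degree at most
    [d]: the monomial of [U] is the indicator of [U \subset S].  The
    inductive form makes the closure properties immediate. *)
Inductive degree_le d : ({set I} -> R) -> Prop :=
| DegreeMonomial U of (#|U| <= d)%N : degree_le d (fun S => (U \subset S)%:R)
| DegreeScale c u of degree_le d u : degree_le d (fun S => c * u S)
| DegreeAdd u v of degree_le d u & degree_le d v : degree_le d (fun S => u S + v S)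
| DegreeEq u v of degree_le d u & u =1 v : degree_le d v.

Lemma degree_const d c : degree_le d (fun=> c).
Proof.
apply: (@DegreeEq _ (fun S => c * (set0 \subset S)%:R)) => [|S].
  by apply: DegreeScale; apply: DegreeMonomial; rewrite cards0.
by rewrite sub0set mulr1.
Qed.

Lemma degree_leW d e u : (d <= e)%N -> degree_le d u -> degree_le e u.
Proof.
move=> de; elim=> [U Ud|c {}u _|{}u v _ + _|{}u v _ + uv].
- by apply: DegreeMonomial; apply: leq_trans de.
- exact: DegreeScale.
- exact: DegreeAdd.
- by move/DegreeEq; apply.
Qed.

Lemma degree_sum d (J : Type) (r : seq J) (P : pred J) (F : J -> {set I} -> R) :
  (forall j, P j -> degree_le d (F j)) ->
  degree_le d (fun S => \sum_(j <- r | P j) F j S).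
Proof.
move=> dF; elim: r => [|j r IHr].
  by apply: DegreeEq (degree_const d 0) _ => S; rewrite big_nil.
have [Pj|nPj] := boolP (P j).
  by apply: DegreeEq (DegreeAdd (dF j Pj) IHr) _ => S; rewrite big_cons Pj.
by apply: DegreeEq IHr _ => S; rewrite big_cons (negPf nPj).
Qed.

Lemma degree_mul d e u v :
  degree_le d u -> degree_le e v -> degree_le (d + e) (fun S => u S * v S).
Proof.
move=> du dv; elim: du => [U Ud|c {}u _ IH|u1 u2 _ IH1 _ IH2|u1 u2 _ IH eu].
- elim: dv => [V Ve|c {}v _ IH|v1 v2 _ IH1 _ IH2|v1 v2 _ IH ev].
  + apply: (@DegreeEq _ (fun S => (U :|: V \subset S)%:R)) => [|S].
      apply: DegreeMonomial; apply: leq_trans (leq_add Ud Ve).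
      by rewrite cardsU leq_subr.
    by rewrite subUset -natrM mulnb.
  + by apply: DegreeEq (DegreeScale c IH) _ => S; rewrite mulrCA.
  + by apply: DegreeEq (DegreeAdd IH1 IH2) _ => S; rewrite mulrDr.
  by apply: DegreeEq IH _ => S; rewrite ev.
- by apply: DegreeEq (DegreeScale c IH) _ => S; rewrite mulrA.
- by apply: DegreeEq (DegreeAdd IH1 IH2) _ => S; rewrite mulrDl.
by apply: DegreeEq IH _ => S; rewrite eu.
Qed.

Lemma degree_prod d (J : Type) (r : seq J) (F : J -> {set I} -> R) :
  (forall j, degree_le d (F j)) ->
  degree_le (size r * d) (fun S => \prod_(j <- r) F j S).
Proof.
move=> dF; elim: r => [|j r IHr].
  by apply: DegreeEq (degree_const _ 1) _ => S; rewrite big_nil.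
by apply: DegreeEq (degree_mul (dF j) IHr) _ => S; rewrite big_cons.
Qed.

Lemma degree_exp d n u : degree_le d u -> degree_le (n * d) (fun S => u S ^+ n).
Proof.
move=> du; elim: n => [|n IHn]; first exact: degree_const.
by apply: DegreeEq (degree_mul du IHn) _ => S; rewrite exprS.
Qed.

(** A monomial that misses a variable [l] takes the same value on [S] and on
    [l |: S], and these occur with opposite signs. *)
Lemma alternating_sum d u : (d < #|I|)%N -> degree_le d u ->
  \sum_(S : {set I}) (-1) ^+ #|S| * u S = 0.
Proof.
move=> dI; elim=> [U Ud|c {}u _ IH|u1 u2 _ IH1 _ IH2|u1 u2 _ IH eu].
- have [l lU] : exists l, l \notin U.
    apply/existsP; rewrite -negb_forall; apply: contraL Ud => /forallP lU.
    by rewrite -ltnNge (leq_trans dI) // subset_leq_card //; apply/subsetP=> i.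
  rewrite (bigID (fun S : {set I} => l \in S)) /=.
  rewrite (reindex_onto (fun S : {set I} => l |: S)
    (fun S : {set I} => S :\ l)) /=; last first.
    by move=> S lS; rewrite setD1K.
  rewrite (eq_bigl (fun S : {set I} => l \notin S)); last first.
    move=> S; rewrite in_setU1 eqxx /=; apply/eqP/idP => [<-|lS].
      by rewrite !inE eqxx.
    by rewrite setU1K.
  rewrite -big_split big1 //= => S lS.
  rewrite cardsU1 lS exprS mulN1r.
  suff -> : (U \subset l |: S) = (U \subset S) by rewrite mulNr addNr.
  apply/idP/idP => [/subsetP US|US]; last exact: subset_trans US (subsetUr _ _).
  apply/subsetP=> i iU; have := US i iU; rewrite in_setU1 => /predU1P[il|//].
  by rewrite -il iU in lU.
- under eq_bigr => S _ do rewrite mulrCA.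
  by rewrite -mulr_sumr IH mulr0.
- by under eq_bigr => S _ do rewrite mulrDr; rewrite big_split /= IH1 IH2 addr0.
by rewrite -[RHS]IH; apply: eq_bigr => S _; rewrite eu.
Qed.

(** The conjunction of all variables has full degree.  This is what bounds the
    arity in the contradiction. *)
Lemma degree_top d : degree_le d (fun S => (S == setT)%:R) -> (#|I| <= d)%N.
Proof.
move=> du; rewrite leqNgt; apply/negP => /alternating_sum /(_ du).
rewrite (bigD1 setT) //= big1 => [|S /negPf->]; last by rewrite mulr0.
by rewrite eqxx mulr1 addr0 => /eqP; rewrite signr_eq0.
Qed.

End Degree.

(** * Degrees of compatible functions *)

Section Coordinates.
Import GRing.Theory.
Local Open Scope group_scope.
Variables (p : nat) (gT : finGroupType).
Hypothesis p_prime : prime p.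
Variable I : finType.
Implicit Types (A B H N Z : {group gT}) (x y z : gT) (T : {set I} -> gT)
  (phi chi kappa : gT -> 'F_p).

Definition invariant_mod B (X : Type) (phi : gT -> X) :=
  forall x y, congr_mod B x y -> phi x = phi y.

(** The degree of [T] modulo [B]: all functions of the coset [T S B] with values
    in the prime field have degree at most [d]. *)
Definition invariants_degree_le B d T :=
  forall phi, invariant_mod B phi -> degree_le d (fun S => phi (T S)).

Definition hom_killing A B kappa :=
  (forall x y, x \in B -> y \in B -> kappa (x * y) = (kappa x + kappa y)%R) /\
  (forall x, x \in A -> kappa x = 0%R).

Definition affine_over B kappa chi :=
  forall x y, y \in B -> chi (x * y) = (chi x + kappa y)%R.

(** The degree of the next coordinate of [T], measured by all functions that are
    affine along the cosets of [B] and invariant modulo [A].  Quantifying over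
    all of them, not only over one chosen coordinate, spares the scalars that
    would relate the coordinates of different arguments. *)
Definition affines_degree_le A B e T :=
  forall kappa chi, hom_killing A B kappa -> affine_over B kappa chi ->
    degree_le e (fun S => chi (T S)).

Definition coset_rep B x := repr (x *: B).

Lemma coset_rep_congr B x : congr_mod B (coset_rep B x) x.
Proof.
rewrite congr_sym /congr_mod -mem_lcoset; apply: (mem_repr x).
exact: lcoset_refl.
Qed.

Lemma coset_rep_invariant B : invariant_mod B (coset_rep B).
Proof.
move=> x y xy; rewrite /coset_rep; congr repr; apply/esym/lcoset_eqP.
by rewrite mem_lcoset.
Qed.

(** Lagrange interpolation: a function of [m] cosets is a combination of products
    of [m] indicator functions. *)
Lemma degree_invariant_multi B d m (psi : ('I_m -> gT) -> 'F_p)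
    (T : 'I_m -> {set I} -> gT) :
  (forall u v, (forall i, congr_mod B (u i) (v i)) -> psi u = psi v) ->
  (forall i, invariants_degree_le B d (T i)) ->
  degree_le (m * d) (fun S => psi (fun i => T i S)).
Proof.
move=> ipsi dT.
pose ind (q : {ffun 'I_m -> gT}) i S : 'F_p := (coset_rep B (T i S) == q i)%:R%R.
apply: (@DegreeEq _ _ _
  (fun S => \sum_(q : {ffun 'I_m -> gT}) psi q * \prod_(i <- enum 'I_m) ind q i S)%R).
  apply: degree_sum => q _; apply: DegreeScale.
  rewrite -[in X in degree_le X](size_enum_ord m); apply: degree_prod => i.
  apply: (dT i (fun x => (coset_rep B x == q i)%:R%R)) => x y xy.
  by rewrite (coset_rep_invariant xy).
move=> S; pose q0 : {ffun 'I_m -> gT} := [ffun i => coset_rep B (T i S)].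
rewrite (bigD1 q0) //= [X in (_ + X)%R]big1 => [|q qq0]; last first.
  have /existsP[i qi] : [exists i, q i != q0 i].
    rewrite -negb_forall; apply: contra qq0 => /forallP qE.
    by apply/eqP/ffunP => i; apply/eqP.
  rewrite big_enum (bigD1 i) //= /ind eq_sym.
  by rewrite ffunE in qi; rewrite (negPf qi) mul0r mulr0.
rewrite addr0 big1 => [|i _]; last by rewrite /ind ffunE eqxx.
rewrite mulr1; apply: ipsi => i; rewrite ffunE; exact: coset_rep_congr.
Qed.

(** Write each argument as its coset representative modulo [B] times an element
    of [B].  By centrality, the coordinate of [f (T S)] is the sum of a function
    of the cosets modulo [B], of degree at most [m * d], and of a homomorphism
    applied to the parts in [B], which is a sum of affine functions of the
    single arguments.  The bound [e] is therefore stable under [f]. *)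
Lemma degree_generator A B H m d e (f : ('I_m -> gT) -> gT)
    (T : 'I_m -> {set I} -> gT) :
  A <| [set: gT] -> B <| [set: gT] -> B \subset H ->
  central_section H A B -> compatible f -> (m * d <= e)%N ->
  (forall i S, congr_mod H (T i set0) (T i S)) ->
  (forall i, invariants_degree_le B d (T i)) ->
  (forall i, affines_degree_le A B e (T i)) ->
  affines_degree_le A B e (fun S => f (fun i => T i S)).
Proof.
move=> nA nB BH cAB cf mde TH dT eT kappa chi [kD kA] achi.
pose r := coset_rep B.
pose g i := r (T i set0).
(* [L] is the effect of a translation by elements of [B]; centrality makes it
   a homomorphism modulo [A]. *)
pose L (y : 'I_m -> gT) := (f g)^-1 * f (fun i => g i * y i).
have LB (y : 'I_m -> gT) : (forall i, y i \in B) -> L y \in B.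
  by move=> yB; apply: cf => // i; apply: congr_mulr.
have kcongr x y : x \in B -> y \in B -> congr_mod A x y -> kappa x = kappa y.
  move=> xB yB Axy; rewrite -[y in RHS](mulKVg x) kD ?groupM ?groupV //.
  by rewrite (kA _ Axy) addr0.
have LM (y z : 'I_m -> gT) : (forall i, y i \in B) -> (forall i, z i \in B) ->
    kappa (L (fun i => y i * z i)) = (kappa (L y) + kappa (L z))%R.
  move=> yB zB; have [yL zL] := (LB y yB, LB z zB).
  have yzL : L (fun i => y i * z i) \in B by apply: LB => i; rewrite groupM.
  rewrite -kD //; apply: kcongr => //; first exact: groupM.
  have := cAB m f cf g y z (fun i => subsetP BH _ (yB i)) zB.
  rewrite -/(L z) => h; rewrite congr_sym.
  have -> : L (fun i => y i * z i) =
      L y * ((f (fun i => g i * y i))^-1 * f (fun i => g i * y i * z i)).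
    rewrite /L mulgA mulgK; congr (_ * _); apply: (compatible_ext cf) => i.
    by rewrite mulgA.
  by apply: congrM => //; apply: congr_refl.
have L1 : kappa (L (fun=> 1)) = 0%R.
  rewrite kA // /L (@compatible_ext _ _ _ _ g cf) ?mulVg ?group1 // => i.
  by rewrite mulg1.
pose at_ (i : 'I_m) z := fun j => if j == i then z else 1.
have Lext (y z : 'I_m -> gT) : y =1 z -> L y = L z.
  by move=> yz; rewrite /L; congr (_ * _); apply: (compatible_ext cf) => i; rewrite yz.
have Lsum (y : 'I_m -> gT) : (forall i, y i \in B) ->
    kappa (L y) = (\sum_i kappa (L (at_ i (y i))))%R.
  move=> yB.
  have Ls (s : seq 'I_m) : uniq s ->
      kappa (L (fun i => if i \in s then y i else 1)) =
      (\sum_(i <- s) kappa (L (at_ i (y i))))%R.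
    elim: s => [_|i s IHs /= /andP[is_ us]]; first by rewrite big_nil -[RHS]L1.
    rewrite big_cons -IHs // -LM => [|j|j]; last first.
    - by case: ifP.
    - by rewrite /at_; case: eqP => // ->.
    congr (kappa _); apply: Lext => j; rewrite inE /at_.
    by case: eqP => [->|_] /=; rewrite ?(negPf is_) ?mulg1 ?mul1g.
  rewrite -[RHS]big_enum -Ls ?enum_uniq //=; congr (kappa _); apply: Lext => j.
  by rewrite mem_enum.
(* The contribution of the [i]-th argument to this homomorphism, and the affine
   function [ch i] that it induces on the whole group. *)
pose kap i z := kappa (L (at_ i z)).
have at_B i z : z \in B -> forall j, at_ i z j \in B.
  by move=> zB j; rewrite /at_; case: ifP.
have hkap i : hom_killing A B (kap i).
  split=> [y z yB zB|z zA].
    rewrite /kap -LM; [|exact: at_B|exact: at_B]; congr (kappa _).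
    by apply: Lext => j; rewrite /at_; case: ifP => //; rewrite mulg1.
  apply: kA; apply: cf => // j; apply: congr_mulr.
  by rewrite /at_; case: ifP.
pose ch i x := kap i ((r x)^-1 * x).
have ach i : affine_over B (kap i) (ch i).
  move=> x y yB; rewrite /ch.
  have -> : r (x * y) = r x.
    by apply/esym/coset_rep_invariant/congr_mulr.
  rewrite mulgA; have [kM _] := hkap i; apply: kM => //.
  exact: coset_rep_congr.
apply: (@DegreeEq _ _ _ (fun S =>
    chi (f (fun i => r (T i S))) + \sum_i ch i (T i S))%R).
  apply: DegreeAdd; last by apply: degree_sum => i _; apply: eT (hkap i) (ach i).
  apply: degree_leW mde _.
  apply: (degree_invariant_multi (B := B)
    (psi := fun u => chi (f (fun i => r (u i))))) => //.
  move=> u v uv; congr chi; apply: (compatible_ext cf) => i.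
  exact: coset_rep_invariant.
move=> S; pose y i := (r (T i S))^-1 * T i S.
have yB i : y i \in B by apply: coset_rep_congr.
pose x i := (g i)^-1 * r (T i S).
have xH i : x i \in H.
  have h z := congr_sub BH (coset_rep_congr B z).
  apply: congr_trans (h _) (congr_trans (TH i S) _).
  by rewrite congr_sym; apply: h.
have gx : (fun i => g i * x i) =1 (fun i => r (T i S)) by move=> i; rewrite mulKVg.
have gxy : (fun i => g i * x i * y i) =1 (fun i => T i S).
  by move=> i; rewrite /= mulKVg mulKVg.
have := cAB m f cf g x y xH yB; rewrite -/(L y).
rewrite (compatible_ext cf gx) (compatible_ext cf gxy) => h.
have bB : (f (fun i => r (T i S)))^-1 * f (fun i => T i S) \in B.
  by apply: cf => // i; apply: coset_rep_congr.
rewrite -[f (fun i => T i S)](mulKVg (f (fun i => r (T i S)))) achi //.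
by rewrite -(kcongr _ _ (LB y yB) bB h) Lsum.
Qed.

Lemma hom_with_kernel A B : A <| [set: gT] -> A \subset B -> #|B : A| = p ->
  exists2 kappa, hom_killing A B kappa & forall x, x \in B -> kappa x = 0%R -> x \in A.
Proof.
move=> nA AB iAB.
have cBA : #|B / A| = p by rewrite card_quotient // subT_norm.
have /cyclicP[a aE] : cyclic (B / A) by rewrite prime_cyclic // cBA.
have oa : #[a] = p by rewrite orderE -aE cBA.
have modE (i j : nat) : (i == j %[mod p]) = (a ^+ i == a ^+ j).
  by rewrite eq_expg_mod_order oa.
have dvdE (i : nat) : (p %| i) = (a ^+ i == 1) by rewrite -order_dvdn oa.
pose lg (q : coset_of A) :=
  odflt (Ordinal (prime_gt0 p_prime)) [pick i : 'I_p | a ^+ i == q].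
have lgP x : x \in B -> a ^+ (lg (coset A x)) = coset A x.
  move=> xB; have : coset A x \in B / A by apply: mem_quotient.
  rewrite aE => /cyclePmin[i]; rewrite oa /lg => ip xi.
  by case: pickP => [j /eqP//|/(_ (Ordinal ip)) /=]; rewrite xi eqxx.
exists (fun x => (lg (coset A x))%:R%R); first split.
- move=> x y xB yB; rewrite -natrD -(Fp_nat_mod p_prime) -[RHS](Fp_nat_mod p_prime).
  congr _%:R%R; apply/eqP; rewrite modE expgD !lgP ?groupM //.
  by rewrite cosetM.
- move=> x xA; have xB := subsetP AB _ xA.
  have := lgP x xB; rewrite (coset_id xA) => /eqP; rewrite -dvdE => pl.
  by rewrite -(Fp_nat_mod p_prime) (eqP pl).
move=> x xB /eqP; rewrite -(dvdn_pcharf (pchar_Fp p_prime)) dvdE lgP //.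
by move=> /eqP/coset_idr; apply; apply: (subsetP (subT_norm [set: gT] nA)); rewrite inE.
Qed.

(** A coset of [A] is determined by the coset of [B] together with one affine
    coordinate, and the indicator of a value of this coordinate is a polynomial
    of degree [p - 1] in it, by Fermat's little theorem. *)
Lemma degree_refine A B d e T : A <| [set: gT] -> A \subset B ->
  #|B : A| = p -> invariants_degree_le B d T -> affines_degree_le A B e T ->
  invariants_degree_le A (d + p.-1 * e) T.
Proof.
move=> nA AB iAB dT eT phi iphi.
have [kappa hk kker] := hom_with_kernel nA AB iAB; have [kD kA] := hk.
pose r := coset_rep B.
pose chi x := kappa ((r x)^-1 * x).
have achi : affine_over B kappa chi.
  move=> x y yB; rewrite /chi.
  have -> : r (x * y) = r x by apply/esym/coset_rep_invariant/congr_mulr.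
  by rewrite mulgA kD //; apply: coset_rep_congr.
pose c (q : gT) (v : 'F_p) : 'F_p :=
  oapp phi 0%R [pick x | (r x == q) && (chi x == v)].
have cE x : c (r x) (chi x) = phi x.
  rewrite /c; case: pickP => [y /andP[/eqP ry /eqP chy]|/(_ x)]; last by rewrite !eqxx.
  apply: iphi.
  have Byx : y^-1 * x \in B.
    apply: congr_trans (coset_rep_congr B x); rewrite congr_sym -/(r x) -ry.
    exact: coset_rep_congr.
  rewrite /congr_mod; apply: kker => //.
  have := achi y _ Byx; rewrite mulKVg chy => /eqP.
  by rewrite -subr_eq0 opprD addNKr oppr_eq0 => /eqP.
apply: (@DegreeEq _ _ _ (fun S => \sum_(q : gT) \sum_(v : 'F_p) c q v *
   ((r (T S) == q)%:R * (1 - (chi (T S) - v) ^+ p.-1)))%R).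
  apply: degree_sum => q _; apply: degree_sum => v _; apply: DegreeScale.
  apply: degree_mul.
    apply: (dT (fun x => (r x == q)%:R%R)) => x y xy.
    by rewrite /r (coset_rep_invariant xy).
  apply: DegreeAdd; first exact: degree_const.
  apply: (@DegreeEq _ _ _ (fun S => -1 * (chi (T S) - v) ^+ p.-1)%R).
    apply: DegreeScale; apply: degree_exp; apply: DegreeAdd; first exact: eT achi.
    exact: degree_const.
  by move=> S; rewrite mulN1r.
move=> S; rewrite (bigD1 (r (T S))) //= [X in (_ + X)%R]big1 => [|q qr]; last first.
  by rewrite big1 // => v _; rewrite eq_sym (negPf qr) mul0r mulr0.
rewrite addr0 (bigD1 (chi (T S))) //= big1 => [|v vc]; last first.
  have nz : (chi (T S) - v != 0)%R by rewrite subr_eq0 eq_sym.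
  have -> : ((chi (T S) - v) ^+ p.-1 = 1)%R.
    apply: (mulfI nz); rewrite -exprS prednK ?prime_gt0 // mulr1.
    by have := expf_card (chi (T S) - v)%R; rewrite card_Fp.
  by rewrite subrr !mulr0.
rewrite eqxx subrr expr0n addr0 mul1r.
have -> : (p.-1 == 0)%N = false.
  by apply/negbTE; rewrite -lt0n -ltnS prednK ?prime_gt0 ?prime_gt1.
by rewrite subr0 mulr1 cE.
Qed.

End Coordinates.

(** * Degrees in finitely generated clones *)

Section BoundedDegree.
Import GRing.Theory.
Local Open Scope group_scope.
Variables (p : nat) (gT : finGroupType).
Hypotheses (p_prime : prime p).
Variables (F : seq (any_operation gT)).
Hypothesis F_cp : forall f, f \in F -> congruence_preserving (tagged f).
Variables (H : {group gT}) (c : gT).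
Hypotheses (nH : H <| [set: gT]) (cH : c \in H).
Implicit Types (A B D E N Z : {group gT}).

Definition cube_point k (S : {set 'I_k}) : 'I_k -> gT :=
  fun i => if i \in S then c else 1.

(** A bound on the degree modulo [B] that is uniform in the arity. *)
Definition expressible_degree_le B d :=
  forall k (f : ('I_k -> gT) -> gT), expressible F f ->
    invariants_degree_le p B d (fun S => f (cube_point S)).

(** The bound for the affine coordinates depends on the arities of the generators
    only, and composition preserves it; hence the induction over the clone is
    stated for compositions with expressible functions that already satisfy it. *)
Lemma expressible_degree_refine A B d :
  A <| [set: gT] -> B <| [set: gT] -> A \subset B -> B \subset H ->
  #|B : A| = p -> central_section H A B ->
  expressible_degree_le B d -> exists e, expressible_degree_le A e.
Proof.
move=> nA nB AB BH iAB cAB dB.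
(* The successor makes room for the variables themselves, whose degree is 1. *)
pose m := \max_(f <- F) tag f; pose e := (m * d).+1.
suff main k (t : operation gT k) : generated_clone F t ->
    forall n (g : 'I_k -> ('I_n -> gT) -> gT), (forall i, expressible F (g i)) ->
    (forall i, affines_degree_le p A B e (fun S => g i (cube_point S))) ->
    affines_degree_le p A B e
      (fun S => t (mktuple (fun i => g i (cube_point S)))).
  exists (d + p.-1 * e) => k f gf.
  apply: (degree_refine p_prime nA AB iAB (dB k f gf)).
  have [t Ft ft] := gf.
  have := main k t Ft k (fun i u => u i) (@expressible_proj _ _ _).
  move=> h kappa chi hk achi.
  apply: (@DegreeEq _ _ _ (fun S => chi (t (mktuple (cube_point S))))); last first.
    by move=> S; rewrite ft.
  apply: h hk achi => i kappa' chi' _ _.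
  apply: (@DegreeEq _ _ _ (fun S : {set 'I_k} =>
    (chi' 1%g + (chi' c - chi' 1%g) * ([set i] \subset S)%:R)%R)).
    apply: DegreeAdd; first exact: degree_const.
    by apply: DegreeScale; apply: DegreeMonomial; rewrite cards1.
  move=> S; rewrite sub1set /cube_point; case: (i \in S).
    by rewrite mulr1 addrC subrK.
  by rewrite mulr0 addr0.
elim=> {k t} [f Ff|k i|k l t h Ft IHt Fh IHh] n g gg eg.
- have [_ cf] := (congruence_preservingP _).1 (F_cp Ff).
  have cg i := expressible_compatible F_cp (gg i).
  apply: (degree_generator (H := H) (d := d) (T := fun i S => g i (cube_point S))
           nA nB BH cAB cf) => //.
  + by apply: leqW; rewrite leq_mul2r /m; apply/orP; right; apply: leq_bigmax_seq.
  + move=> i S; apply: cg => // j; rewrite /cube_point inE congr_from1.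
    by case: ifP.
  by move=> i; apply: dB.
- move=> kappa chi hk achi.
  apply: (DegreeEq (eg i kappa chi hk achi)) => S.
  by rewrite ffunE tnth_mktuple.
move=> kappa chi hk achi.
apply: (@DegreeEq _ _ _ (fun S => chi (t (mktuple
   (fun j => h j (mktuple (fun i => g i (cube_point S)))))))); last first.
  by move=> S; rewrite ffunE.
apply: (IHt n (fun j u => h j (mktuple (fun i => g i u)))) hk achi => [j|j].
  apply: (expressible_comp (f := fun v => h j (mktuple v))) => //.
  by exists (h j).
exact: IHh.
Qed.

Lemma expressible_degree_bounded Z : Z <| [set: gT] -> Z \subset H ->
  (forall B, B <| [set: gT] -> Z \subset B -> B \subset H -> ~~ (B \subset Z) ->
    exists A, [/\ A <| [set: gT], Z \subset A, A \subset B,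
      #|B : A| = p & central_section H A B]) ->
  exists d, expressible_degree_le Z d.
Proof.
move=> nZ ZH ser.
suff main n B : (#|B| <= n)%N -> B <| [set: gT] -> Z \subset B -> B \subset H ->
    (exists d, expressible_degree_le B d) -> exists d, expressible_degree_le Z d.
  apply: (main _ H (leqnn _) nH ZH (subxx _)); exists 0%N => k f gf phi iphi.
  apply: (@DegreeEq _ _ _ (fun=> phi (f (fun=> 1)))); first exact: degree_const.
  move=> S; apply: iphi; apply: (expressible_compatible F_cp gf) => // i.
  by rewrite congr_from1 /cube_point; case: ifP.
elim: n B => [|n IHn] B; first by rewrite leqNgt cardG_gt0.
move=> Bn nB ZB BH [d dB]; have [BZ|nBZ] := boolP (B \subset Z).
  exists d; suff -> : Z = B by [].
  by apply/group_inj/eqP; rewrite eqEsubset ZB.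
have [A [nA ZA AB iA cA]] := ser B nB ZB BH nBZ.
apply: (IHn A) => //.
- rewrite -ltnS; apply: leq_trans Bn; rewrite -(Lagrange AB) iA.
  by rewrite ltn_Pmulr ?prime_gt1 ?cardG_gt0.
- exact: subset_trans BH.
exact: expressible_degree_refine AB BH iA cA dB.
Qed.

(** When every normal subgroup is below [D] or above [E], any function with
    values in [E] that depends on the arguments modulo [D] only is congruence
    preserving.  This applies to the conjunction of [d + 1] conditions
    [u i \in c D], which has degree [d + 1]. *)
Lemma unbounded_degree Z D E d :
  (forall N, N <| [set: gT] -> N \subset D \/ E \subset N) ->
  c \notin D -> ~~ (E \subset Z) ->
  (forall k (t : operation gT k), congruence_preserving t -> generated_clone F t) ->
  ~ expressible_degree_le Z d.
Proof.
move=> cDE cD /subsetPn[e eE eZ] gen dZ.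
pose f (u : 'I_d.+1 -> gT) := if [forall i, congr_mod D c (u i)] then e else 1.
have cf : compatible f.
  move=> N nN u v uv; rewrite /f; case: (cDE N nN) => [ND|EN].
    rewrite (eq_forallb (P2 := fun i => congr_mod D c (v i))) ?congr_refl // => i.
    have uvD := congr_sub ND (uv i).
    apply/idP/idP => h; apply: (congr_trans h) => //; by rewrite congr_sym.
  have eN := subsetP EN e eE.
  by rewrite /congr_mod groupM ?groupV //; case: ifP.
have gf : expressible F f.
  exists [ffun w : (d.+1).-tuple gT => f (tnth w)].
    apply: gen; apply/congruence_preservingP; split=> // N nN u v uv.
    by rewrite !ffunE; apply: cf => // i; rewrite !tnth_mktuple.
  by move=> u; rewrite ffunE; apply: (compatible_ext cf) => i; rewrite tnth_mktuple.
have h : degree_le d (fun S => (congr_mod Z e (f (cube_point S)))%:R%R : 'F_p).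
  apply: (dZ _ f gf (fun x => (congr_mod Z e x)%:R%R)) => x y xy.
  congr (_%:R%R); congr nat_of_bool.
  apply/idP/idP => h; apply: (congr_trans h) => //; by rewrite congr_sym.
suff: (#|'I_d.+1| <= d)%N by rewrite card_ord ltnn.
apply: (degree_top (R := 'F_p)); apply: (DegreeEq h) => S; rewrite /f.
have -> : [forall i, congr_mod D c (cube_point S i)] = (S == setT).
  apply/forallP/eqP => [a|-> i]; last by rewrite /cube_point inE congr_refl.
  apply/setP=> i; rewrite inE; move: (a i); rewrite /cube_point.
  by case: ifP => // _; rewrite congr_sym congr_from1 (negPf cD).
case: eqP => _; first by rewrite congr_refl.
by rewrite congr_sym congr_from1 (negPf eZ).
Qed.

End BoundedDegree.

(** * The characterization *)

Section SmallOperations.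
Variables (gT : finGroupType) (B : nat).

Definition small_operations : seq (any_operation gT) :=
  flatten [seq [seq Tagged (operation gT) f
    | f <- enum (@congruence_preservingb gT k)] | k <- iota 0 B.+1].

Lemma small_operationsP k (f : operation gT k) : k <= B ->
  congruence_preserving f -> Tagged (operation gT) f \in small_operations.
Proof.
move=> kB cf; apply/flatten_mapP; exists k; first by rewrite mem_iota.
by apply: map_f; rewrite mem_enum; apply/congruence_preservingbP.
Qed.

Lemma small_operations_cp f :
  f \in small_operations -> congruence_preserving (tagged f).
Proof.
move=> /flatten_mapP[k _ /mapP[t]]; rewrite mem_enum => ct ->.
exact/congruence_preservingbP.
Qed.

End SmallOperations.

Section Interval.
Import Order.TTheory.
Local Open Scope order_scope.

Lemma card_interval2 d (L : finLatticeType d) (a b : L) : a < b ->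
  #|interval a b| = 2%N <-> (forall c, c \in interval a b -> c = a \/ c = b).
Proof.
move=> ab; have c2 : #|pred2 a b| = 2%N by rewrite card2 lt_eqF.
have sub : pred2 a b \subset interval a b.
  apply/subsetP=> c; rewrite !inE => /orP[] /eqP->; by rewrite !lexx ltW.
split=> [ci c|h].
  have /subset_cardP/(_ sub) E : #|pred2 a b| = #|interval a b| by rewrite ci.
  by rewrite -E => /orP[] /eqP ->; [left|right].
rewrite -c2; apply: eq_card => c; apply/idP/idP => [/h|/(subsetP sub)//].
by rewrite !inE => -[] ->; rewrite eqxx ?orbT.
Qed.

End Interval.

Section Main.
Variables (p : nat) (gT : finGroupType) (n : nat) (N : nat -> normal_subgroup gT).
Hypotheses (p_prime : prime p) (pG : (p.-group [set: gT])%g).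
Hypotheses (N_first : N 0 = \bot%O) (N_last : N n = \top%O)
  (N_increasing : forall i, i < n -> (N i < N i.+1)%O)
  (N_cutting : forall M : normal_subgroup gT, cuts M <-> exists2 i, i <= n & N i = M).
Local Open Scope group_scope.

Implicit Types (C : {group gT}) (i j : nat).

Lemma cut_comparable i C : i <= n -> C <| [set: gT] ->
  C \subset N i \/ N i \subset C.
Proof.
move=> i_n nC; have : cuts (N i) by apply/N_cutting; exists i.
by move=> /(_ (NormalSubgroup nC)).
Qed.

Lemma cut_mono i j : i <= j -> j <= n -> N i \subset N j.
Proof.
elim: j => [|j IHj]; first by rewrite leqn0 => /eqP->.
rewrite leq_eqVlt ltnS => /predU1P[-> //|ij] jn.
apply: subset_trans (IHj ij (ltnW jn)) _.
by have := N_increasing jn; rewrite Order.POrderTheory.lt_neqAle => /andP[].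
Qed.

Lemma cut_strict i : i < n -> N i \subset N i.+1 /\ ~~ (N i.+1 \subset N i).
Proof.
by move=> /N_increasing; rewrite Order.POrderTheory.lt_leAnge => /andP[].
Qed.

Lemma no_intermediate_cut i (C : {group gT}) : i < n -> C <| [set: gT] ->
  ~~ (C \subset N i) -> ~~ (N i.+1 \subset C) ->
  exists E : {group gT}, [/\ E <| [set: gT], ~~ (C \subset E) & ~~ (E \subset C)].
Proof.
move=> i_n nC CNi NiC.
have [/existsP[E /andP[CE EC]]|/existsPn noE] :=
    boolP [exists E : normal_subgroup gT, ~~ (C \subset E) && ~~ (E \subset C)].
  by exists E; split=> //; apply: normal_subgroupP.
have : cuts (NormalSubgroup nC).
  move=> E; have := noE E; rewrite negb_and !negbK => /orP[CE|EC]; [by right|by left].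
move/N_cutting=> [j j_n Nj]; have CE : C = N j by rewrite Nj.
case: (ltnP i j) => ij.
  by case/negP: NiC; rewrite CE cut_mono.
by case/negP: CNi; rewrite CE cut_mono // ltnW.
Qed.

Lemma in_interval (A B C : normal_subgroup gT) :
  (C \in interval A B) = (A \subset C) && (C \subset B).
Proof. by []. Qed.

Lemma lt_normal_subgroup (A B : normal_subgroup gT) :
  (A < B)%O = (A \subset B) && ~~ (B \subset A).
Proof. by rewrite Order.POrderTheory.lt_leAnge. Qed.

Lemma not_splits_non_splitting (A B : normal_subgroup gT) :
  ~ interval_splits A B -> non_splitting A B.
Proof.
move=> nsp D E nD nE AD DB AE EB nBD nEA.
have [/existsP[C /and4P[AC CB CD EC]]|/existsPn noC] :=
    boolP [exists C : normal_subgroup gT,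
      [&& A \subset C, C \subset B, ~~ (C \subset D) & ~~ (E \subset C)]].
  by exists C; split=> //; apply: normal_subgroupP.
case: nsp; exists (NormalSubgroup nD), (NormalSubgroup nE).
split; rewrite ?in_interval ?lt_normal_subgroup ?AD ?DB ?AE ?EB //= => C.
rewrite in_interval => /andP[AC CB]; have := noC C.
by rewrite AC CB /= negb_and !negbK => /orP[]; [left|right].
Qed.

(** Suppose that the interval from [N i] to [N i.+1] splits and has a further
    element.  As it contains no cutting elements in its interior, all its
    sections are central, so finite generation bounds the degrees modulo [N i];
    the splitting pair provides functions of arbitrarily large degree. *)
Lemma finitely_generated_condition :
  finitely_generated (@congruence_preserving gT) ->
  forall i, i < n -> #|interval (N i) (N i.+1)| = 2 \/
     ~ interval_splits (N i) (N i.+1).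
Proof.
move=> [F [F_cp F_gen]] i i_n.
have [c2|nc2] := eqVneq #|interval (N i) (N i.+1)| 2; first by left.
right=> -[D [E [DI EI ltD ltE sp]]].
move: DI EI; rewrite !in_interval => /andP[ZD DH] /andP[ZE EH].
move: ltD ltE; rewrite !lt_normal_subgroup => /andP[_ nHD] /andP[_ nEZ].
have [ZH nHZ] := cut_strict i_n.
have nZ := normal_subgroupP (N i); have nH := normal_subgroupP (N i.+1).
have cutZ C : C <| [set: gT] -> _ := @cut_comparable i C (ltnW i_n).
have cutH C : C <| [set: gT] -> _ := @cut_comparable i.+1 C i_n.
have not_two : exists C : {group gT}, [/\ C <| [set: gT], N i \subset C,
    C \subset N i.+1, ~~ (C \subset N i) & ~~ (N i.+1 \subset C)].
  have [/existsP[C /and4P[AC CB CD EC]]|/existsPn noC] :=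
    boolP [exists C : normal_subgroup gT, [&& N i \subset C, C \subset N i.+1,
      ~~ (C \subset N i) & ~~ (N i.+1 \subset C)]].
    by exists C; split=> //; apply: normal_subgroupP.
  case/eqP: nc2; apply/card_interval2; first exact: N_increasing.
  move=> C; rewrite in_interval => /andP[ZC CH]; have := noC C.
  rewrite ZC CH /= negb_and !negbK => /orP[CZ|HC]; [left|right];
    by apply/Order.POrderTheory.le_anti/andP.
have cutDE C : C <| [set: gT] -> C \subset D \/ E \subset C.
  move=> nC; case: (cutZ C nC) => [CZ|ZC]; first by left; apply: subset_trans ZD.
  case: (cutH C nC) => [CH|HC]; last by right; apply: subset_trans HC.
  by apply: (sp (NormalSubgroup nC)); rewrite in_interval ZC.
have /subsetPn[c cH cD] := nHD.
have [|d] := @expressible_degree_bounded p gT p_prime F F_cp (N i.+1) c nH cH (N i) nZ ZH.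
  move=> C nC ZC CH nCZ.
  apply: (@central_series gT (N i.+1) p p_prime pG (N i)) => // C1 nC1 ZC1 CH1.
  exact: no_intermediate_cut.
exact: (@unbounded_degree p gT F c (N i) D E d cutDE cD nEZ F_gen).
Qed.

(** All operations of arity at most the order of the group plus two generate.  A
    given function is approximated modulo [N n], [N n.-1], and so on down to
    the trivial group; at each step the remaining error [e] has values in
    [N i.+1] and has to be approximated modulo [N i]. *)
Lemma condition_finitely_generated :
  (forall i, i < n -> #|interval (N i) (N i.+1)| = 2 \/
     ~ interval_splits (N i) (N i.+1)) ->
  finitely_generated (@congruence_preserving gT).
Proof.
move=> cond; pose B := #|gT|.+2.
have F_all := @small_operationsP gT B; have F_cp := @small_operations_cp gT B.
exists (small_operations gT B); split; first exact: F_cp.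
move=> k f /congruence_preservingP[k0 cf].
suff main j : j <= n -> exists2 h, expressible (small_operations gT B) h &
    forall u, congr_mod (N (n - j)) (f (mktuple u)) (h u).
  have [h [t Ft th] hP] := main n (leqnn n).
  suff -> : f = t by [].
  apply/ffunP=> w; have -> : w = mktuple (tnth w).
    by apply: eq_from_tnth => i; rewrite tnth_mktuple.
  rewrite th; have := hP (tnth w).
  by rewrite subnn N_first /congr_mod inE -eq_mulVg1 => /eqP.
elim: j => [_|j IHj j_n].
  exists (fun=> 1%g); first exact: (expressible_const _ F_all).
  by move=> u; rewrite subn0 N_last /congr_mod inE.
have [h gh hP] := IHj (ltnW j_n).
pose i := n - j.+1; have i1 : n - j = i.+1 by rewrite /i -subSn ?subSS.
have i_n : i < n by rewrite -i1 leq_subr.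
rewrite i1 in hP; rewrite -/i.
have ch := expressible_compatible F_cp gh.
have [ZH nHZ] := cut_strict i_n.
have nZ := normal_subgroupP (N i); have nH := normal_subgroupP (N i.+1).
pose e u := (h u)^-1 * f (mktuple u).
have ce : compatible e by apply: compatibleM cf; apply: compatibleV.
have eH u : e u \in N i.+1 by have := hP u; rewrite congr_sym.
suff [h' gh' h'P] : exists2 h', expressible (small_operations gT B) h' &
    forall u, congr_mod (N i) (e u) (h' u).
  exists (fun u => h u * h' u); first exact: (expressibleM _ F_all).
  move=> u; rewrite -[f _](mulKVg (h u)); apply: congrM => //; first exact: congr_refl.
  exact: h'P.
have [/(card_interval2 (N_increasing i_n)) two|nsp] := cond i i_n.
  (* Cosets of [N i]: on each of them [e] is constant modulo [N i]. *)
  apply: (expressible_glue _ F_all nZ ZH ZH k0 _ ce eH) => // [C nC|g].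
    case: (cut_comparable (ltnW i_n) nC) => [|ZC]; first by left.
    case: (cut_comparable i_n nC) => [CH|]; last by right.
    have [|E|E] := two (NormalSubgroup nC); first by rewrite in_interval ZC.
      by left; rewrite -E.
    by right; rewrite -E.
  exists (fun=> e g); first exact: (expressible_const _ F_all).
  by move=> u ug; rewrite congr_sym; apply: ce.
(* Cosets of [N i.+1]: translated to the coset of 1, [e] is approximated there. *)
apply: (expressible_glue _ F_all nH ZH (subxx _) k0 _ ce eH) => // [C nC|g].
  exact: cut_comparable.
have [|||h' gh' h'P] := @expressible_non_splitting gT _ B F_cp isT F_all (N i) (N i.+1) k
   (fun u => e (fun l => g l * u l)) nZ nH ZH (not_splits_non_splitting nsp) _ k0.
- by rewrite ltnS ltnW // ltnS max_card.
- apply: (compatible_comp ce (g := fun l u => g l * u l)) => l.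
  by apply: compatibleM; [apply: compatible_const|apply: compatible_proj].
- by move=> u _; apply: eH.
exists (fun u => h' (fun l => (g l)^-1 * u l)).
  apply: (expressible_comp gh') => l.
  apply: (expressibleVM _ F_all) => //; last exact: expressible_proj.
  exact: (expressible_const _ F_all).
move=> u ug; have := h'P (fun l => (g l)^-1 * u l) ug.
by rewrite (compatible_ext ce (v := u)) // => l; rewrite mulKVg.
Qed.

End Main.

Theorem theorem2p2 (p : nat) (gT : finGroupType) (n : nat)
    (N : nat -> normal_subgroup gT)
    (p_prime : prime p)
    (pG : (p.-group [set: gT])%g)
    (N_first : N 0 = \bot%O)
    (N_last : N n = \top%O)
    (N_increasing : forall i, i < n -> (N i < N i.+1)%O)
    (N_cutting : forall M : normal_subgroup gT,
       cuts M <-> exists2 i, i <= n & N i = M) :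
  finitely_generated (@congruence_preserving gT) <->
  (forall i, i < n ->
     #|interval (N i) (N i.+1)| = 2 \/
     ~ interval_splits (N i) (N i.+1)).
Proof.
split; first exact: (finitely_generated_condition p_prime pG N_increasing N_cutting).
exact: (condition_finitely_generated N_first N_last N_increasing N_cutting).
Qed.
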